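(* There is an absolute constant $c>0$ such that the following holds. Let $n,d\ge1$ be integers and let $Z_1,\dots,Z_n$ be independent copies of a centered random vector $Z\in\mathbb{R}^d$ with covariance matrix $\Sigma=\mathbb{E}(ZZ^\top)\ne0$ such that, for a certain $\eta\ge1$ and every $u\in\mathbb{R}^d$ and $p\ge1$, $$\left(\mathbb{E}\left(|\langle u,Z\rangle|^p\right)\right)^{1/p}\le\eta\,p\,\|u\|_\Sigma .$$ Let $r=\operatorname{tr}(\Sigma)/\|\Sigma\|_{\mathrm{op}}$. Then for any $t\ge0$, with probability at least $1-e^{-t}$, $$\left\|\frac1n\sum_{i=1}^nZ_iZ_i^\top-\Sigma\right\|_{\mathrm{op}}\le\begin{cases}c\,\eta^2\|\Sigma\|_{\mathrm{op}}\max\left\{\dfrac{(r+t+\log 8)^2}{n},\ \left(\dfrac{r+t+\log 8}{n}\right)^{1/2}\right\},&\text{if } r\le n^{1/3},\\[2ex] c\,\eta^2\|\Sigma\|_{\mathrm{op}}\max\left\{\dfrac{(n^{1/3}+t+\log 8)^2}{n},\ \dfrac{r\,(n^{1/3}+t+\log 8)}{n}\right\},&\text{if } r>n^{1/3}.\end{cases}$$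
   Context: $\|u\|_\Sigma=\sqrt{u^\top\Sigma u}$ and $\|\cdot\|_{\mathrm{op}}$ is the operator (spectral) norm. *)

(* Defs.v *)
From mathcomp Require Import all_boot all_order all_algebra.
From mathcomp Require Import all_classical all_reals all_analysis.

Set Implicit Arguments.
Unset Strict Implicit.
Unset Printing Implicit Defensive.

Import Order.TTheory GRing.Theory Num.Theory.
Import numFieldNormedType.Exports.

Local Open Scope classical_set_scope.
Local Open Scope ring_scope.

Section euclidean.
Context {R : realType} {d : nat}.
Implicit Types (u v : 'cV[R]_d) (A S : 'M[R]_d).

Definition dotv u v : R := (u^T *m v) 0 0.

(* The library norm on matrices is the max norm, hence a separate Euclidean
   norm. *)
Definition norm2 u : R := Num.sqrt (dotv u u).

Definition normS S u : R := Num.sqrt ((u^T *m S *m u) 0 0).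

Definition opnorm A : R := sup [set norm2 (A *m u) | u in [set u | norm2 u <= 1]].

Definition effective_rank S : R := \tr S / opnorm S.

End euclidean.

(* R^d with its Borel sigma-algebra; as a type it is 'cV[R]_d. *)
Definition borel_cV (R : realType) (d : nat) : measurableType _ :=
  g_sigma_algebraType (@open 'cV[R]_d).

Section random_elements.
Context {R : realType} {disp disp' : measure_display}
  {T : measurableType disp} {T' : measurableType disp'}.
Variable P : probability T R.

(* The entrywise expectation of M exists and equals A.  Since +oo - oo is
   infinite in \bar R, an equality with a real entails that the entry is
   integrable as soon as it is measurable. *)
Definition has_mean m n (M : T -> 'M[R]_(m, n)) (A : 'M[R]_(m, n)) : Prop :=
  forall i j, ('E_P[fun w => M w i j] = (A i j)%:E)%E.

Definition independent_RVs (I : finType) (X : I -> {RV P >-> T'}) : Prop :=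
  forall (J : {set I}) (B : I -> set T'), (forall i, measurable (B i)) ->
    P (\bigcap_(i in [set` J]) (X i @^-1` B i)) =
    (\prod_(i in J) P (X i @^-1` B i))%E.

End random_elements.

Definition same_distribution {R : realType} {d1 d2 d' : measure_display}
    {T1 : measurableType d1} {T2 : measurableType d2}
    {T' : measurableType d'} (P1 : probability T1 R) (P2 : probability T2 R)
    (X1 : {RV P1 >-> T'}) (X2 : {RV P2 >-> T'}) : Prop :=
  forall B : set T', measurable B ->
    distribution P1 X1 B = distribution P2 X2 B.

Definition sample_covariance {R : realType} {d n : nat} (z : 'I_n -> 'cV[R]_d) :
    'M[R]_d :=
  n%:R^-1 *: \sum_(i < n) z i *m (z i)^T.

(* The right-hand side of the deviation bound, with s the operator norm of the
   covariance matrix and r its effective rank. *)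
Definition deviation_bound {R : realType} (c eta s r t : R) (n : nat) : R :=
  let N : R := n%:R in
  let k : R := N `^ 3^-1 in
  if r <= k then
    c * eta ^+ 2 * s *
      Num.max ((r + t + ln 8) ^+ 2 / N) (Num.sqrt ((r + t + ln 8) / N))
  else
    c * eta ^+ 2 * s *
      Num.max ((k + t + ln 8) ^+ 2 / N) (r * (k + t + ln 8) / N).

(* Main.v *)
(* A PAC-Bayes argument, with a discrete randomization in place of the usual
   Gaussian smoothing.  A vector [u] of the unit ball is replaced by the random
   vector [rvec th] with mean [u], whose coordinates are averages of [K] biased
   random signs.  Relative to unbiased signs its entropy is at most [K / 4], and
   its energy for [Sigma] is of order [opnorm Sigma + \tr Sigma / K], so that no
   dimension enters; [K] is of order [r], or of order [n^(1/3) + t] when [r] is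
   larger.  Averaging the product of two independent randomizations recovers
   [dotv u (Zs i w) * dotv v (Zs i w)] exactly.
   The products are clipped at a level [1 / scale], and the Donsker-Varadhan
   inequality controls the clipped sums at all [u], [v] at once.  What exceeds
   the clipping level is bounded by the square of the sum of the large
   [`|dotv u (Zs i w)|], plus a noise term that does not depend on [u].  That sum
   is again controlled by Donsker-Varadhan: one gets rid of the randomization by
   Khintchine's inequality, restricted to the randomizations of bounded energy,
   for which [dotv (rvec th) Z] has exponential moments.  Squaring the resulting
   bound, of order [K + t], gives the term [(K + t)^2 / n]. *)

Require Import Defs.
From mathcomp Require Import all_boot all_order all_algebra.
From mathcomp Require Import all_classical all_reals all_analysis.
From mathcomp Require Import measurable_realfun lebesgue_measure lebesgue_integral.
From mathcomp Require Import ring lra.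

Set Implicit Arguments.
Unset Strict Implicit.
Unset Printing Implicit Defensive.

Import Order.TTheory GRing.Theory Num.Theory.
Import numFieldNormedType.Exports.

Local Open Scope classical_set_scope.
Local Open Scope ring_scope.

(** * Biased random signs *)

(** A product of two subexponential variables need not have any exponential moment, so only its
    clipped part can enter an exponential inequality. The clipping level [(g * q) ^+ 2] is governed
    by a free parameter [q]: each observation adds to the rates an error of order [q ^- 4], which
    forces [n <= x * q ^+ 4] with [x = K + t + ln 8], and the resulting deviation is of order
    [g ^+ 2 * (q ^+ 2 * x + x ^+ 2) / n]. The best choice, [q ^+ 4 = max (1, n / x)], turns the
    first term into [sqrt (x / n)] as soon as [x <= n]. The term [x ^+ 2 / n] dominates
    [sqrt (x / n)] once [x ^+ 3 >= n]; this is the origin of [n^(1/3)]. Beyond that point increasing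
    [K] would be paid quadratically. One rather inflates the upper bound [sb] on the operator norm,
    which enters linearly, so as to keep the one constraint that links the two,
    [\tr Sigma <= K * sb]. Signs take finitely many values, so every average over the randomization
    is a finite sum, and it commutes with the integrals at no cost. *)

Section elementary_inequalities.
Context {R : realType}.
Implicit Types x y : R.

(** Writing [expR x] as the square of [expR (x / 2) <= (1 - x / 2)^-1] leaves a polynomial
    inequality whose defect factors explicitly. There is no lower bound on [x]. *)
Lemma expR_le_quad x : x <= 1 -> expR x <= 1 + x + 2 * x ^+ 2.
Proof.
move=> x1.
have h : 0 < 1 - x / 2 by lra.
have e1 : expR (x / 2) <= (1 - x / 2)^-1.
  rewrite -[x / 2]opprK expRN lef_pV2 ?posrE ?expR_gt0 ?opprK//.
  by have := expR_ge1Dx (- (x / 2)).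
have -> : expR x = expR (x / 2) ^+ 2 by rewrite -expRM_natr; congr expR; field.
have /le_trans : expR (x / 2) ^+ 2 <= (1 - x / 2)^-1 ^+ 2.
  by rewrite lerXn2r ?nnegrE ?expR_ge0 ?invr_ge0 ?(ltW h).
apply; rewrite exprVn -[leLHS]mul1r ler_pdivrMr ?exprn_gt0//.
rewrite -subr_ge0 (_ : _ - _ = x ^+ 2 * ((1 - x) * (5 / 4 - x / 2))); last by field.
by rewrite mulr_ge0 ?sqr_ge0// mulr_ge0//; lra.
Qed.

(** For a centered variable the term [y] averages out, so that a bounded centered variable is seen
    to be sub-Gaussian. *)
Lemma expR_le_add_expR_sqr y : expR y <= y + expR (2 * y ^+ 2).
Proof.
have [y1|y1] := leP y 1.
  have := expR_le_quad y1; have := expR_ge1Dx (2 * y ^+ 2); lra.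
have : expR y <= expR (2 * y ^+ 2) by rewrite ler_expR; nra.
lra.
Qed.

Lemma expr4_le_expR_norm x : x ^+ 4 <= 24 * (expR x + expR (- x)).
Proof.
suff h y : 0 <= y -> y ^+ 4 <= 24 * expR y.
  have [x0|x0] := leP 0 x.
    have := h _ x0; have := expR_ge0 (- x); lra.
  have /h : 0 <= - x by lra.
  have := expR_ge0 x; rewrite exprNn -signr_odd /= mul1r; lra.
move=> y0; have := expR_ge1Dxn 3 y0.
have -> : (4`!%:R : R) = 24 by [].
lra.
Qed.

Definition clip1 x : R := Num.max (-1) (Num.min x 1).

(** Clipping makes the exponential integrable while the right-hand side keeps the unclipped [x]: the
    mean is not biased by the clipping. *)
Lemma expR_clip1_le x : expR (clip1 x) <= 1 + x + 2 * x ^+ 2.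
Proof.
rewrite /clip1; have [x1|x1] := leP x 1.
  have [x2|x2] := leP (-1) x; first exact: expR_le_quad.
  have : expR (-1) <= (1:R) by rewrite expR_le1; lra.
  nra.
rewrite max_r; last by lra.
have := expR_le_quad (lexx 1); nra.
Qed.

Lemma le_clip1 x : x <= clip1 x + Num.max 0 (`|x| - 1).
Proof.
rewrite /clip1; have [x1|x1] := leP x 1.
  have : x <= Num.max (-1) x by rewrite le_max lexx orbT.
  have : 0 <= Num.max 0 (`|x| - 1) by rewrite le_max lexx.
  lra.
have : `|x| - 1 <= Num.max 0 (`|x| - 1) by rewrite le_max lexx orbT.
rewrite (@max_r _ _ (-1) 1); last by lra.
by rewrite gtr0_norm; lra.
Qed.

End elementary_inequalities.

Section tilted_signs.
Context {R : realType} {J : finType}.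
Implicit Types (m c : J -> R) (F G : {ffun J -> bool} -> R).

Definition sg (b : bool) : R := if b then 1 else -1.

(** The law of independent random signs with means [m j]; [tilt (fun=> 0)] is the uniform law, used
    as the prior. *)
Definition tilt m (th : {ffun J -> bool}) : R := \prod_j ((1 + sg (th j) * m j) / 2).

Definition tE m F : R := \sum_th tilt m th * F th.

Lemma tilt_ge0 m th : (forall j, `|m j| <= 1) -> 0 <= tilt m th.
Proof.
move=> m1; apply: prodr_ge0 => j _; have := m1 j; rewrite ler_norml /sg.
by case: (th j) => /andP[? ?]; lra.
Qed.

Lemma tE_prod m (g : J -> bool -> R) :
  tE m (fun th => \prod_j g j (th j)) =
  \prod_j ((1 + m j) / 2 * g j true + (1 - m j) / 2 * g j false).
Proof.
transitivity (\prod_j \sum_(b : bool) (1 + sg b * m j) / 2 * g j b).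
  by rewrite bigA_distr_bigA; apply: eq_bigr => th _; rewrite -big_split.
by apply: eq_bigr => j _; rewrite big_bool /sg mul1r mulN1r.
Qed.

Lemma tE_eq m F G : F =1 G -> tE m F = tE m G.
Proof. by move=> FG; apply: eq_bigr => th _; rewrite FG. Qed.

Lemma tE_cst m k : tE m (fun=> k) = k.
Proof.
suff h : \sum_th tilt m th = 1 by rewrite /tE -mulr_suml h mul1r.
transitivity (tE m (fun th => \prod_(j : J) (1 : R))).
  by apply: eq_bigr => th _; rewrite big1_eq mulr1.
by rewrite (tE_prod m (fun _ _ => 1)); apply: big1 => j _; field.
Qed.

Lemma tED m F G : tE m (fun th => F th + G th) = tE m F + tE m G.
Proof. by rewrite -big_split; apply: eq_bigr => th _; rewrite mulrDr. Qed.

Lemma tEZ m k F : tE m (fun th => k * F th) = k * tE m F.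
Proof. by rewrite mulr_sumr; apply: eq_bigr => th _; rewrite mulrCA. Qed.

Lemma tE_sum (I : finType) m (F : I -> {ffun J -> bool} -> R) :
  tE m (fun th => \sum_i F i th) = \sum_i tE m (F i).
Proof.
rewrite exchange_big; apply: eq_bigr => th _.
by rewrite mulr_sumr.
Qed.

Lemma ler_tE m F G : (forall j, `|m j| <= 1) -> (forall th, F th <= G th) ->
  tE m F <= tE m G.
Proof. by move=> m1 FG; apply: ler_sum => th _; rewrite ler_wpM2l ?tilt_ge0. Qed.

Lemma tE_sg m j : tE m (fun th => sg (th j)) = m j.
Proof.
pose g k b := if k == j then sg b else 1.
rewrite -(tE_eq _ (F := fun th => \prod_k g k (th k))); last first.
  move=> th; rewrite (bigD1 j)//= /g eqxx big1 ?mulr1// => k /negbTE kj.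
  by rewrite kj.
rewrite tE_prod (bigD1 j)//= /g eqxx big1 => [|k /negbTE ->]; last by field.
by rewrite /sg; field.
Qed.

Lemma tE_sg2 m i j : tE m (fun th => sg (th i) * sg (th j)) =
  m i * m j + (i == j)%:R * (1 - m i ^+ 2).
Proof.
have [<-|ij] := eqVneq i j.
  rewrite (tE_eq _ (G := fun=> 1)) ?tE_cst; first by rewrite /=; ring.
  by move=> th; rewrite /sg; case: ifP => _; ring.
pose g k b := if k == i then sg b else if k == j then sg b else 1.
have ji : j == i = false by rewrite eq_sym; exact: negbTE.
rewrite -(tE_eq _ (F := fun th => \prod_k g k (th k))); last first.
  move=> th; rewrite (bigD1 i)//= (bigD1 j) ?ji//= /g eqxx ji eqxx big1 ?mulr1//.
  by move=> k /andP[/negbTE -> /negbTE ->].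
rewrite tE_prod (bigD1 i)//= (bigD1 j) ?ji//= /g eqxx ji eqxx big1 => [|k /andP[/negbTE -> /negbTE ->]]; last by field.
by rewrite /sg /=; field.
Qed.

Lemma tE_linear m c : tE m (fun th => \sum_j c j * sg (th j)) = \sum_j c j * m j.
Proof. by rewrite tE_sum; apply: eq_bigr => j _; rewrite tEZ tE_sg. Qed.

Lemma tE_bilinear m (q : J -> J -> R) :
  tE m (fun th => \sum_i \sum_j q i j * (sg (th i) * sg (th j))) =
  \sum_i \sum_j q i j * (m i * m j) + \sum_j q j j * (1 - m j ^+ 2).
Proof.
rewrite tE_sum -big_split; apply: eq_bigr => i _ /=.
rewrite tE_sum (eq_bigr (fun j => q i j * (m i * m j) +
    q i j * ((i == j)%:R * (1 - m i ^+ 2)))) => [|j _]; last first.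
  by rewrite tEZ tE_sg2 mulrDr.
rewrite big_split /=; congr (_ + _).
rewrite (bigD1 i)//= eqxx mul1r big1 ?addr0// => j; rewrite eq_sym => /negbTE ->.
by rewrite mul0r mulr0.
Qed.

(** The expectation factors over [j]; each factor is centered and [sg (th j) - m j] is at most 2 in
    absolute value, whence [2 * (2 * c j) ^+ 2]. *)
Lemma tE_expR_noise m c : (forall j, `|m j| <= 1) ->
  tE m (fun th => expR (\sum_j c j * (sg (th j) - m j))) <=
  expR (8 * \sum_j c j ^+ 2).
Proof.
move=> m1; rewrite (tE_eq _ (G := fun th => \prod_j expR (c j * (sg (th j) - m j)))).
  rewrite (tE_prod _ (fun j b => expR (c j * (sg b - m j)))) mulr_sumr expR_sum.
  apply: ler_prod => j _; have := m1 j; rewrite ler_norml => /andP[m1' m1''].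
  rewrite addr_ge0 ?mulr_ge0 ?expR_ge0//=; [|lra|lra].
  have /= h1 := expR_le_add_expR_sqr (c j * (sg true - m j)).
  have /= h2 := expR_le_add_expR_sqr (c j * (sg false - m j)).
  have c2 := sqr_ge0 (c j).
  have le_sqr4 (x : R) : -2 <= x <= 2 -> 2 * (c j * x) ^+ 2 <= 8 * c j ^+ 2.
    move=> /andP[x1 x2]; rewrite exprMn; have : x ^+ 2 <= 4 by nra.
    by move=> /(ler_wpM2l c2); lra.
  have h3 : expR (2 * (c j * (sg true - m j)) ^+ 2) <= expR (8 * c j ^+ 2).
    by rewrite ler_expR /sg; apply: le_sqr4; lra.
  have h4 : expR (2 * (c j * (sg false - m j)) ^+ 2) <= expR (8 * c j ^+ 2).
    by rewrite ler_expR /sg; apply: le_sqr4; lra.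
  have a0 : 0 <= (1 + m j) / 2 by lra.
  have b0 : 0 <= (1 - m j) / 2 by lra.
  apply: le_trans (lerD (ler_wpM2l a0 (le_trans h1 (lerD (lexx _) h3)))
    (ler_wpM2l b0 (le_trans h2 (lerD (lexx _) h4)))) _.
  by rewrite le_eqVlt; apply/orP; left; apply/eqP; rewrite /sg; field.
by move=> th; rewrite expR_sum.
Qed.

Definition kurt : R := 48 * expR 8.

Lemma kurt_ge1 : 1 <= kurt.
Proof. by rewrite /kurt; have := expR_ge1Dx (8 : R); lra. Qed.

(** After normalization by [s], the square root of the variance proxy, both exponential moments are
    at most [expR 8], and [x ^+ 4 <= 24 * (expR x + expR (- x))] yields [kurt]. The case of a zero
    proxy is separate because of the division by [s]. *)
Lemma tE_noise4 m c : (forall j, `|m j| <= 1) ->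
  tE m (fun th => (\sum_j c j * (sg (th j) - m j)) ^+ 4) <=
  kurt * (\sum_j c j ^+ 2) ^+ 2.
Proof.
move=> m1; set N := \sum_j c j ^+ 2.
have N0 : 0 <= N by apply: sumr_ge0 => j _; exact: sqr_ge0.
have [/eqP N00|Np] := eqVneq N 0.
  have c0 j : c j = 0.
    apply/eqP; rewrite -sqrf_eq0; move: N00; rewrite psumr_eq0 => [|i _]; last exact: sqr_ge0.
    by move=> /allP/(_ j); rewrite mem_index_enum; exact.
  rewrite (tE_eq _ (G := fun=> 0)) => [|th]; last first.
    by rewrite big1 ?expr0n// => j _; rewrite c0 mul0r.
  by rewrite tE_cst; move/eqP: N00 => ->; rewrite expr0n mulr0.
have {}Np : 0 < N by rewrite lt_neqAle eq_sym Np.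
pose s := Num.sqrt N; have s0 : 0 < s by rewrite sqrtr_gt0.
have sN : s ^+ 2 = N by rewrite sqr_sqrtr.
pose x th := \sum_j c j / s * (sg (th j) - m j).
have cs (e : R) : e ^+ 2 = 1 -> tE m (fun th => expR (e * x th)) <= expR 8.
  move=> e2; have := tE_expR_noise (fun j => e * c j / s) m1.
  rewrite [X in _ <= expR (8 * X)](_ : _ = 1) ?mulr1; last first.
    rewrite (eq_bigr (fun j => c j ^+ 2 * (s ^+ 2)^-1)) => [|j _].
      by rewrite -mulr_suml sN divff// gt_eqF.
    by rewrite !exprMn e2 mul1r exprVn.
  apply: le_trans; apply: ler_tE => // th; rewrite ler_expR /x mulr_sumr.
  by apply: ler_sum => j _; rewrite !mulrA.
have : tE m (fun th => N ^+ 2 * (24 * (expR (1 * x th) + expR (-1 * x th)))) <=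
    kurt * N ^+ 2.
  rewrite !tEZ tED mulrC ler_pM2r ?exprn_gt0//.
  have := cs 1; have := cs (-1); rewrite sqrrN expr1n => /(_ erefl) h1 /(_ erefl) h2.
  rewrite /kurt; lra.
apply: le_trans; apply: ler_tE => // th.
have -> : \sum_j c j * (sg (th j) - m j) = s * x th.
  rewrite /x mulr_sumr; apply: eq_bigr => j _; field; exact: lt0r_neq0.
rewrite exprMn (exprM s 2 2) sN ler_pM2l ?exprn_gt0// mul1r mulN1r.
exact: expr4_le_expR_norm.
Qed.

(** Here [l] is the log-density relative to unbiased signs and [tE m l] the relative entropy;
    [ln (1 + y) <= y] bounds it. Strictness of the hypothesis keeps the logarithms finite. *)
Lemma tE_loglik m : (forall j, `|m j| < 1) ->
  exists2 l : {ffun J -> bool} -> R,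
    (forall th, tilt m th = tilt (fun=> 0) th * expR (l th)) &
    tE m l <= \sum_j m j ^+ 2.
Proof.
move=> m1.
have sgm b j : 0 < 1 + sg b * m j.
  by have := m1 j; rewrite ltr_norml /sg => /andP[]; case: b; lra.
exists (fun th => \sum_j ln (1 + sg (th j) * m j)) => [th|].
  rewrite expR_sum /tilt -big_split; apply: eq_bigr => j _ /=.
  by rewrite lnK ?posrE//; field.
apply: (@le_trans _ _ (tE m (fun th => \sum_j m j * sg (th j)))).
  apply: ler_tE => [j|th]; first exact: ltW.
  apply: ler_sum => j _; rewrite mulrC; apply: le_ln1Dx.
  by have := sgm (th j) j; lra.
by rewrite tE_linear.
Qed.

End tilted_signs.

(** Instead of Jensen's inequality, [1 + y <= expR y] is averaged under [rho] at
    [y = F i - l i - t]: the change of measure makes the exponential average at most 1. *)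
Lemma donsker_varadhan {R : realType} {I : finType} (mu rho l F : I -> R) (t : R) :
    (forall i, 0 <= rho i) -> (\sum_i rho i = 1) ->
    (forall i, rho i = mu i * expR (l i)) ->
    \sum_i mu i * expR (F i) <= expR t ->
  \sum_i rho i * F i <= t + \sum_i rho i * l i.
Proof.
move=> rho0 rho1 rhoE h.
suff : \sum_i rho i * (F i - l i - t) <= 0.
  rewrite (eq_bigr (fun i => rho i * F i - rho i * l i - rho i * t)) => [|i _]; last by ring.
  by rewrite !sumrB -mulr_suml rho1 mul1r; lra.
apply: (@le_trans _ _ (\sum_i (mu i * expR (F i) * expR (- t) - rho i))).
  apply: ler_sum => i _.
  have -> : mu i * expR (F i) * expR (- t) = rho i * expR (F i - l i - t).
    by rewrite rhoE !expRD !expRN; field; rewrite !gt_eqF ?expR_gt0.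
  have := ler_wpM2l (rho0 i) (expR_ge1Dx (F i - l i - t)); lra.
rewrite sumrB -mulr_suml rho1 subr_le0.
by rewrite expRN ler_pdivrMr ?expR_gt0// mul1r.
Qed.

(** * Products of independent variables and the PAC-Bayes inequality *)

Lemma ge0_integralZl_real {R : realType} d (T : measurableType d)
    (m : {measure set T -> \bar R}) (k : R) (f : T -> R) :
    0 <= k -> measurable_fun [set: T] f -> (forall x, 0 <= f x) ->
  (\int[m]_x (k * f x)%:E = k%:E * \int[m]_x (f x)%:E)%E.
Proof.
move=> k0 mf f0; under eq_integral do rewrite EFinM.
rewrite ge0_integralZl ?lee_fin//; first exact/measurable_EFinP.
by move=> x _; rewrite lee_fin.
Qed.

Section independence.
Context {R : realType} {d d' : measure_display}
  {T : measurableType d} {T' : measurableType d'} (P : probability T R).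
Local Open Scope ereal_scope.

Import HBNNSimple.

(** Passes from indicators of [Y] to all nonnegative functions of [Y], through simple functions and
    monotone convergence. *)
Lemma ge0_integral_mul_comp (H : T -> R) (Y : {RV P >-> T'}) (c : R)
    (g : T' -> R) :
    measurable_fun [set: T] H -> (forall x, 0 <= H x)%R -> (0 <= c)%R ->
    measurable_fun [set: T'] g -> (forall y, 0 <= g y)%R ->
    (forall B, measurable B ->
      \int[P]_x (H x * \1_B (Y x))%:E = c%:E * P (Y @^-1` B)) ->
  \int[P]_x (H x * g (Y x))%:E = c%:E * \int[P]_x (g (Y x))%:E.
Proof.
move=> mH H0 c0 mg g0 HB.
have mY : measurable_fun [set: T] Y by exact: measurable_funPT.
have mge : measurable_fun [set: T'] (fun y => (g y)%:E) by exact/measurable_EFinP.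
pose g_ := nnsfun_approx measurableT mge.
have g_g y : (g_ k y)%:E @[k --> \oo] --> (g y)%:E.
  by apply: (cvg_nnsfun_approx measurableT mge) => // x _; rewrite lee_fin.
have nd_g m k y : (m <= k)%N -> (g_ m y <= g_ k y)%R.
  by move=> mk; have /lefP := nd_nnsfun_approx measurableT mge mk; apply.
have simple k : \int[P]_x (H x * g_ k (Y x))%:E =
    c%:E * \int[P]_x (g_ k (Y x))%:E.
  have [N [s [B [s0 mB gE]]]] : exists N (s : 'I_N -> R) (B : 'I_N -> set T'),
      [/\ forall i, (0 <= s i)%R, forall i, measurable (B i) &
          forall y, g_ k y = (\sum_(i < N) s i * \1_(B i) y)%R].
    pose r : seq R := finmap.enum_fset (fset_set (g_ k @` [set: T'])).
    exists _, (fun i : 'I_(size r) => r`_i)%R, (fun i => g_ k @^-1` [set r`_i]%R); split.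
    - move=> i; have : (r`_i)%R \in r by rewrite mem_nth.
      by rewrite /r in_fset_set// inE/= => -[y _ <-].
    - by move=> i; exact: measurable_sfunP.
    - by move=> y; rewrite fimfunE fsbig_finite//= (big_nth 0%R) big_mkord.
  have mind i : measurable_fun [set: T] (fun x => \1_(B i) (Y x) : R).
    by apply: measurableT_comp => //; exact: measurable_indic.
  have i0 i x : (0 <= s i * \1_(B i) (Y x))%R by rewrite mulr_ge0// indicE.
  transitivity (\int[P]_x \sum_(i < N) (s i)%:E * (H x * \1_(B i) (Y x))%:E).
    apply: eq_integral => x _; rewrite gE mulr_sumr -sumEFin.
    by apply: eq_bigr => i _; rewrite -EFinM mulrCA.
  transitivity (c%:E * \int[P]_x \sum_(i < N) (s i)%:E * (\1_(B i) (Y x))%:E); last first.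
    congr (_ * _); apply: eq_integral => x _; rewrite gE -sumEFin.
    by apply: eq_bigr => i _; rewrite -EFinM.
  rewrite ge0_integral_sum//; last 2 first.
  - by move=> i; apply/measurable_EFinP; apply: measurable_funM => //; exact: measurable_funM.
  - by move=> i x _; rewrite -EFinM lee_fin mulr_ge0// mulr_ge0// indicE.
  rewrite ge0_integral_sum//; last 2 first.
  - by move=> i; apply/measurable_EFinP; apply: measurable_funM.
  - by move=> i x _; rewrite -EFinM lee_fin.
  rewrite ge0_sume_distrr; last first.
    by move=> i _; apply: integral_ge0 => x _; rewrite -EFinM lee_fin.
  apply: eq_bigr => i _.
  under eq_integral do rewrite -EFinM.
  rewrite ge0_integralZl_real//; last 2 first.
  - exact: measurable_funM.
  - by move=> x; rewrite mulr_ge0// indicE.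
  under [in RHS]eq_integral do rewrite -EFinM.
  rewrite ge0_integralZl_real//.
  rewrite HB// muleCA; congr (_ * (_ * _)).
  rewrite -(setIT (Y @^-1` B i)) -integral_indic//.
  by rewrite -[X in measurable X]setTI; exact: mY.
have l1 : \int[P]_x (H x * g_ k (Y x))%:E @[k --> \oo] -->
    \int[P]_x (H x * g (Y x))%:E.
  rewrite (_ : (fun x => (H x * g (Y x))%:E) =
      (fun x => limn (fun k => (H x * g_ k (Y x))%:E))); last first.
    apply/funext => x; apply/esym/cvg_lim => //.
    by under eq_fun do rewrite EFinM; rewrite EFinM; apply: cvgeZl.
  apply: cvg_monotone_convergence => //.
  - move=> k; apply/measurable_EFinP; apply: measurable_funM => //.
    exact: measurableT_comp.
  - by move=> k x _; rewrite lee_fin mulr_ge0.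
  - by move=> x _ m k mk; rewrite lee_fin ler_wpM2l// nd_g.
have l2 : \int[P]_x (g_ k (Y x))%:E @[k --> \oo] --> \int[P]_x (g (Y x))%:E.
  rewrite (_ : (fun x => (g (Y x))%:E) =
      (fun x => limn (fun k => (g_ k (Y x))%:E))); last first.
    by apply/funext => x; apply/esym/cvg_lim => //.
  apply: cvg_monotone_convergence => //.
  - by move=> k; apply/measurable_EFinP; exact: measurableT_comp.
  - by move=> k x _; rewrite lee_fin.
  - by move=> x _ m k mk; rewrite lee_fin nd_g.
have l3 : \int[P]_x (H x * g_ k (Y x))%:E @[k --> \oo] -->
    c%:E * \int[P]_x (g (Y x))%:E.
  by rewrite (funext simple); apply: cvgeZl.
exact: (cvg_unique _ l1 l3).
Qed.

Lemma ge0_integral_prod_indep (I : finType) (Y : I -> {RV P >-> T'})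
    (g : I -> T' -> R) (e : I -> R) :
    independent_RVs Y ->
    (forall i, measurable_fun [set: T'] (g i)) -> (forall i y, 0 <= g i y)%R ->
    (forall i, \int[P]_x (g i (Y i x))%:E = (e i)%:E) ->
  \int[P]_x (\prod_i g i (Y i x))%:E = (\prod_i e i)%:E.
Proof.
move=> indep mg g0 eE.
have mY i : measurable_fun [set: T] (Y i) by exact: measurable_funPT.
have e0 i : (0 <= e i)%R.
  by rewrite -lee_fin -eE; apply: integral_ge0 => x _; rewrite lee_fin.
have PE i B : measurable B -> P (Y i @^-1` B) = (fine (P (Y i @^-1` B)))%:E.
  by move=> mB; rewrite fineK// fin_num_measure// -[X in measurable X]setTI; exact: mY.
(* Indicators are replaced by the functions [g i] one index at a time. The sets stay arbitrary
   because replacing the indicator at [i0] uses the induction hypothesis for every measurable set at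
   that index. *)
suff Q (s : seq I) (B : I -> set T') : (forall i, measurable (B i)) ->
    \int[P]_x (\prod_i (if i \in s then g i (Y i x) else \1_(B i) (Y i x)))%:E =
    (\prod_i (if i \in s then e i else fine (P (Y i @^-1` B i))))%:E.
  have := Q (enum I) (fun=> setT) (fun=> measurableT).
  under eq_integral do under eq_bigr do rewrite mem_enum /=.
  by move=> ->; congr EFin; apply: eq_bigr => i _; rewrite mem_enum.
elim: s B => [|i0 s IH] B mB.
  change (\int[P]_x (\prod_i \1_(B i) (Y i x))%:E =
    (\prod_i fine (P (Y i @^-1` B i)))%:E).
  have -> : (\prod_i fine (P (Y i @^-1` B i)))%:E =
      P (\bigcap_(i in [set` [set: I]%SET]) (Y i @^-1` B i)).
    rewrite indep// -prodEFin [RHS](eq_bigl xpredT) => [|i]; last exact: finset.in_setT.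
    by apply: eq_bigr => i _; rewrite -PE.
  set S := \bigcap_(i in _) _.
  have mS : measurable S.
    apply: fin_bigcap_measurable; first exact: finite_finset.
    by move=> i _; rewrite -[X in measurable X]setTI; exact: mY.
  rewrite -(setIT S) -integral_indic//.
  apply: eq_integral => x _; congr EFin; rewrite indicE.
  have [xB|xB] := boolP (x \in _).
    apply: big1 => i _; rewrite indicE mem_set//.
    by move: xB; rewrite inE => /(_ i); apply; rewrite /= finset.in_setT.
  apply/eqP; rewrite prodf_seq_eq0; apply/hasP.
  have /existsNP[i /not_implyP[_ xBi]] : ~ (forall i, [set` [set: I]%SET] i -> (Y i @^-1` B i) x).
    by move=> h; move: xB; rewrite notin_setE; exact.
  exists i; first by rewrite mem_index_enum.
  by rewrite /= indicE memNset ?eqxx.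
have [i0s|i0s] := boolP (i0 \in s).
  have sE i : (i \in i0 :: s) = (i \in s).
    by rewrite inE; case: eqVneq => [->|].
  under eq_integral do under eq_bigr do rewrite sE.
  by under [in RHS]eq_bigr do rewrite sE; exact: IH.
pose F i x := if i \in s then g i (Y i x) else \1_(B i) (Y i x) : R.
pose H x := (\prod_(i | i != i0) F i x)%R.
pose c := (\prod_(i | i != i0) (if i \in s then e i else fine (P (Y i @^-1` B i))))%R.
have F0 i x : (0 <= F i x)%R by rewrite /F; case: ifP => // _; rewrite indicE.
have mF i : measurable_fun [set: T] (F i).
  rewrite /F; case: (i \in s); last exact: measurableT_comp.
  exact: measurableT_comp.
have sE i : i != i0 -> (i \in i0 :: s) = (i \in s) by rewrite inE => /negbTE ->.
transitivity (\int[P]_x (H x * g i0 (Y i0 x))%:E).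
  apply: eq_integral => x _; rewrite (bigD1 i0)//= mem_head mulrC; congr (_ * _)%:E.
  by apply: eq_bigr => i /sE ->.
have cE : (\prod_(i | i != i0) (if i \in i0 :: s then e i else fine (P (Y i @^-1` B i))))%R = c.
  by apply: eq_bigr => i /sE ->.
rewrite (bigD1 i0)//= mem_head cE EFinM -eE muleC.
apply: ge0_integral_mul_comp => //.
- by rewrite /H; under eq_fun do rewrite -big_filter; exact: measurable_prod.
- by move=> x; exact: prodr_ge0.
- by apply: prodr_ge0 => i _; case: ifP => // _; rewrite fine_ge0.
move=> A mA; pose B' i := if i == i0 then A else B i.
have mB' i : measurable (B' i) by rewrite /B'; case: ifP.
have := IH B' mB'.
have -> : (\prod_i (if i \in s then e i else fine (P (Y i @^-1` B' i))))%:E = c%:E * P (Y i0 @^-1` A).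
  rewrite (bigD1 i0)//= (negbTE i0s) {1}/B' eqxx EFinM -PE// muleC; congr (_%:E * _).
  by apply: eq_bigr => i /negbTE ii0; rewrite /B' ii0.
move=> <-; apply: eq_integral => x _; congr EFin.
rewrite [RHS](bigD1 i0)//= (negbTE i0s) {1}/B' eqxx mulrC; congr (_ * _)%R.
by apply: eq_bigr => i /negbTE ii0; rewrite /F /B' ii0.
Qed.

End independence.

Section pac_bayes.
Context {R : realType} {d0 d d' : measure_display} {T0 : measurableType d0}
  {T : measurableType d} {T' : measurableType d'}
  (P0 : probability T0 R) (P : probability T R).
Local Open Scope ereal_scope.

Lemma ge0_integral_same_distribution (X : {RV P >-> T'}) (Z : {RV P0 >-> T'})
    (g : T' -> R) :
    same_distribution X Z ->
    measurable_fun [set: T'] g -> (forall y, 0 <= g y)%R ->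
  \int[P]_x (g (X x))%:E = \int[P0]_x (g (Z x))%:E.
Proof.
move=> XZ mg g0.
have mge : measurable_fun [set: T'] (fun y => (g y)%:E) by exact/measurable_EFinP.
have ge0 y : 0 <= (g y)%:E by rewrite lee_fin.
rewrite -[LHS](ge0_integral_distribution X mge ge0).
rewrite -[RHS](ge0_integral_distribution Z mge ge0).
by apply: eq_measure_integral => A mA _; exact: XZ.
Qed.

(** By independence each summand of [G] has expectation at most [mu i], so [G] has expectation at
    most 1 and Markov's inequality applies. The event does not depend on a posterior, which is what
    makes later bounds uniform. *)
Lemma pac_bayes (n : nat) (Z : {RV P0 >-> T'}) (Zs : 'I_n -> {RV P >-> T'})
    (I : finType) (mu : I -> R) (f : I -> T' -> R) (kap : I -> R) (t : R) :
    independent_RVs Zs -> (forall k, same_distribution (Zs k) Z) ->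
    (forall i, 0 <= mu i)%R -> (\sum_i mu i = 1)%R ->
    (forall i, measurable_fun [set: T'] (f i)) ->
    (forall i, \int[P0]_w (expR (f i (Z w)))%:E <= (expR (kap i))%:E) ->
  let G w := (\sum_i mu i * expR (\sum_(k < n) f i (Zs k w) - n%:R * kap i))%R in
  measurable [set w | expR t < G w]%R /\
  P [set w | expR t < G w]%R <= (expR (- t))%:E.
Proof.
move=> indep idd mu0 mu1 mf Ef G.
have mZs k : measurable_fun [set: T] (Zs k) by exact: measurable_funPT.
have mX i : measurable_fun [set: T]
    (fun w => expR (\sum_(k < n) f i (Zs k w) - n%:R * kap i))%R.
  apply: measurableT_comp => //; apply: measurable_funB => //.
  by apply: measurable_sum => k; exact: measurableT_comp.
have mG : measurable_fun [set: T] G.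
  by apply: measurable_sum => i; exact: measurable_funM.
have G0 w : (0 <= G w)%R.
  by apply: sumr_ge0 => i _; rewrite mulr_ge0// expR_ge0.
have mA : measurable [set w | expR t < G w]%R.
  rewrite (_ : [set w | _] = G @^-1` `]expR t, +oo[%classic); last first.
    by apply/seteqP; split => w /=; rewrite in_itv/= andbT.
  by rewrite -[X in measurable X]setTI; exact: mG.
split => //.
have EG : \int[P]_w (G w)%:E <= 1.
  under eq_integral do rewrite -sumEFin.
  rewrite ge0_integral_sum//; last 2 first.
  - by move=> i; apply/measurable_EFinP; exact: measurable_funM.
  - by move=> i w _; rewrite lee_fin mulr_ge0// expR_ge0.
  rewrite (_ : 1 = \sum_i (mu i)%:E); last by rewrite sumEFin mu1.
  apply: lee_sum => i _.
  rewrite ge0_integralZl_real//.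
  rewrite -[leRHS]mule1; apply: lee_wpmul2l; first by rewrite lee_fin.
  pose e : R := fine (\int[P0]_w (expR (f i (Z w) - kap i))%:E).
  have mfk : measurable_fun [set: T'] (fun y => expR (f i y - kap i)).
    by apply: measurableT_comp => //; exact: measurable_funB.
  have e1 : \int[P0]_w (expR (f i (Z w) - kap i))%:E <= 1.
    under eq_integral do rewrite expRB mulrC.
    have mfZ : measurable_fun [set: T0] (fun w => expR (f i (Z w))).
      have mZ : measurable_fun [set: T0] Z by exact: measurable_funPT.
      by apply: measurableT_comp => //; exact: (measurableT_comp (mf i) mZ).
    rewrite ge0_integralZl_real ?invr_ge0 ?expR_ge0//.
    rewrite -lee_pdivlMl ?invr_gt0 ?expR_gt0// invrK mule1; exact: Ef.
  have e0 : 0 <= \int[P0]_w (expR (f i (Z w) - kap i))%:E.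
    by apply: integral_ge0 => w _; rewrite lee_fin expR_ge0.
  have eE : \int[P0]_w (expR (f i (Z w) - kap i))%:E = e%:E.
    by rewrite fineK// ge0_fin_numE// (le_lt_trans e1)// ltry.
  have : \int[P]_x (\prod_(k < n) expR (f i (Zs k x) - kap i))%:E = (\prod_(k < n) e)%:E.
    apply: (ge0_integral_prod_indep (g := fun _ y => expR (f i y - kap i)) indep) => //.
    move=> k; rewrite -eE.
    exact: (ge0_integral_same_distribution (idd k) mfk (fun=> expR_ge0 _)).
  rewrite [X in X <= _](_ : _ = \int[P]_x (\prod_(k < n) expR (f i (Zs k x) - kap i))%:E); last first.
    apply: eq_integral => x _; congr EFin; rewrite -expR_sum; congr expR.
    by rewrite sumrB sumr_const card_ord mulr_natl.
  move=> ->; rewrite lee_fin prodr_const exprn_ile1//.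
    by rewrite -lee_fin -eE.
  by rewrite -lee_fin -eE.
rewrite expRN -(@lee_pmul2l _ (expR t)%:E) ?lte_fin ?expR_gt0//.
rewrite -EFinM divff ?gt_eqF ?expR_gt0//; apply: le_trans EG.
rewrite -(setIT [set w | _]) -integral_indic//.
rewrite -ge0_integralZl_real ?expR_ge0//.
apply: ge0_le_integral => //.
- by apply/measurable_EFinP; exact: measurable_funM.
- exact/measurable_EFinP.
move=> w _; rewrite lee_fin indicE; have [|] := boolP (w \in _).
  by rewrite inE/= mulr1 => /ltW.
by rewrite mulr0.
Qed.

End pac_bayes.

(** * The operator norm *)

Section euclidean_theory.
Context {R : realType} {d : nat}.
Implicit Types (u v w : 'cV[R]_d) (A B : 'M[R]_d).

Lemma dotvE u v : dotv u v = \sum_j u j 0 * v j 0.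
Proof. by rewrite /dotv mxE; apply: eq_bigr => j _; rewrite mxE. Qed.

Lemma dotvC u v : dotv u v = dotv v u.
Proof. by rewrite !dotvE; apply: eq_bigr => j _; rewrite mulrC. Qed.

Lemma dotvDr u v w : dotv u (v + w) = dotv u v + dotv u w.
Proof. by rewrite /dotv mulmxDr mxE. Qed.

Lemma dotvZr a u v : dotv u (a *: v) = a * dotv u v.
Proof. by rewrite /dotv -scalemxAr mxE. Qed.

Lemma dotvDl u v w : dotv (u + v) w = dotv u w + dotv v w.
Proof. by rewrite !(dotvC _ w) dotvDr. Qed.

Lemma dotvZl a u v : dotv (a *: u) v = a * dotv u v.
Proof. by rewrite !(dotvC _ v) dotvZr. Qed.

Lemma dotvv_ge0 u : 0 <= dotv u u.
Proof. by rewrite dotvE; apply: sumr_ge0 => j _; rewrite -expr2 sqr_ge0. Qed.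

Lemma dotvv_eq0 u : (dotv u u == 0) = (u == 0).
Proof.
apply/eqP/eqP => [|->]; last by rewrite dotvE big1// => j _; rewrite mxE mul0r.
rewrite dotvE => /eqP; rewrite psumr_eq0 => [/allP h|j _]; last by rewrite -expr2 sqr_ge0.
apply/colP => j; rewrite mxE; apply/eqP; rewrite -sqrf_eq0 expr2.
by apply: h; rewrite mem_index_enum.
Qed.

Lemma norm2_ge0 u : 0 <= norm2 u. Proof. exact: sqrtr_ge0. Qed.

Lemma sqr_norm2 u : norm2 u ^+ 2 = dotv u u.
Proof. by rewrite sqr_sqrtr// dotvv_ge0. Qed.

Lemma norm2_eq0 u : (norm2 u == 0) = (u == 0).
Proof. by rewrite -sqrf_eq0 sqr_norm2 dotvv_eq0. Qed.

Lemma norm20 : norm2 (0 : 'cV[R]_d) = 0.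
Proof. by apply/eqP; rewrite norm2_eq0. Qed.

Lemma norm2Z a u : norm2 (a *: u) = `|a| * norm2 u.
Proof. by rewrite /norm2 dotvZl dotvZr mulrA -expr2 sqrtrM ?sqr_ge0// sqrtr_sqr. Qed.

Lemma dotv_norm2_le u v : dotv u v <= norm2 u * norm2 v.
Proof.
have [->|u0] := eqVneq u 0.
  by rewrite norm20 mul0r dotvE big1// => j _; rewrite mxE mul0r.
have up : 0 < dotv u u by rewrite lt_neqAle eq_sym dotvv_eq0 u0 dotvv_ge0.
have [v0|/ltW v0] := leP (dotv u v) 0.
  by apply: le_trans v0 _; rewrite mulr_ge0 ?norm2_ge0.
rewrite -(@ler_pXn2r _ 2) ?nnegrE ?mulr_ge0 ?norm2_ge0// exprMn !sqr_norm2.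
have := dotvv_ge0 (dotv u u *: v + (- dotv u v) *: u).
rewrite !(dotvDl, dotvDr, dotvZl, dotvZr) (dotvC v u).
set a := dotv u u; set b := dotv u v; set c := dotv v v.
rewrite (_ : _ + _ = a * (a * c - b ^+ 2)); last by ring.
by rewrite pmulr_rge0// subr_ge0.
Qed.

Lemma ler_norm2D u v : norm2 (u + v) <= norm2 u + norm2 v.
Proof.
rewrite -(@ler_pXn2r _ 2) ?nnegrE ?addr_ge0 ?norm2_ge0//.
rewrite sqrrD !sqr_norm2 dotvDl !dotvDr (dotvC v u).
by have := dotv_norm2_le u v; lra.
Qed.

Lemma norm2_le_sum u : norm2 u <= \sum_j `|u j 0|.
Proof.
rewrite -(@ler_pXn2r _ 2) ?nnegrE ?norm2_ge0 ?sumr_ge0//.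
rewrite sqr_norm2 dotvE expr2 mulr_suml; apply: ler_sum => j _.
apply: le_trans (ler_norm _) _; rewrite normrM ler_wpM2l//.
by rewrite (bigD1 j)//= lerDl sumr_ge0.
Qed.

(** A crude bound by the norms of the rows, needed only to know that the supremum defining [opnorm]
    is taken over a bounded set, and for continuity. *)
Lemma norm2_mulmx_bounded A : exists2 F, 0 <= F & forall u, norm2 (A *m u) <= F * norm2 u.
Proof.
exists (\sum_i norm2 (row i A)^T); first by rewrite sumr_ge0// => i _; exact: norm2_ge0.
move=> u; apply: le_trans (norm2_le_sum _) _; rewrite mulr_suml.
apply: ler_sum => i _.
have E : (A *m u) i 0 = dotv (row i A)^T u.
  by rewrite mxE dotvE; apply: eq_bigr => j _; rewrite !mxE.
rewrite ler_norml lerNl E dotv_norm2_le andbT.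
rewrite -mulN1r -dotvZl; apply: le_trans (dotv_norm2_le _ _) _.
by rewrite norm2Z normrN1 mul1r.
Qed.

Lemma opnorm_has_sup A : has_sup [set norm2 (A *m u) | u in [set u | norm2 u <= 1]].
Proof.
split; first by exists (norm2 (A *m 0)), 0 => //=; rewrite norm20.
have [F F0 AF] := norm2_mulmx_bounded A.
by exists F => _ [u /= u1 <-]; apply: le_trans (AF u) _; rewrite ler_piMr.
Qed.

Lemma norm2_mulmx_le_opnorm A u : norm2 (A *m u) <= opnorm A * norm2 u.
Proof.
have [->|u0] := eqVneq u 0; first by rewrite mulmx0 !norm20 mulr0.
have up : 0 < norm2 u by rewrite lt_neqAle eq_sym norm2_eq0 u0 norm2_ge0.
rewrite -ler_pdivrMr//.
have <- : norm2 (A *m ((norm2 u)^-1 *: u)) = norm2 (A *m u) / norm2 u.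
  by rewrite -scalemxAr norm2Z ger0_norm ?invr_ge0 ?norm2_ge0// mulrC.
apply: ub_le_sup; first by case: (opnorm_has_sup A).
exists ((norm2 u)^-1 *: u) => //=.
by rewrite norm2Z ger0_norm ?invr_ge0 ?norm2_ge0// mulVf// gt_eqF.
Qed.

Lemma opnorm_ge0 A : 0 <= opnorm A.
Proof.
apply: ub_le_sup; first by case: (opnorm_has_sup A).
by exists 0 => /=; rewrite ?mulmx0 norm20.
Qed.

Lemma opnorm_gt0 A : A != 0 -> 0 < opnorm A.
Proof.
move=> A0; rewrite lt_neqAle opnorm_ge0 andbT eq_sym.
apply: contra A0 => /eqP A0; apply/eqP/matrixP => i j; rewrite mxE.
have := norm2_mulmx_le_opnorm A (delta_mx j 0); rewrite A0 mul0r => h.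
have : norm2 (A *m delta_mx j 0) == 0 by rewrite eq_le h norm2_ge0.
rewrite norm2_eq0 -colE => /eqP/colP/(_ i).
by rewrite !mxE.
Qed.

Lemma opnorm_le A b : 0 <= b -> (forall u, norm2 (A *m u) <= b * norm2 u) ->
  opnorm A <= b.
Proof.
move=> b0 h; apply: ge_sup; first by case: (opnorm_has_sup A).
move=> _ [u /= u1 <-]; apply: le_trans (h u) _; by rewrite ler_piMr.
Qed.

(** Tested at the normalization of [A *m u]. One-sided bounds suffice since the unit ball is
    symmetric. *)
Lemma opnorm_le_bilinear A b : 0 <= b ->
    (forall u v, norm2 u <= 1 -> norm2 v <= 1 -> dotv u (A *m v) <= b) ->
  opnorm A <= b.
Proof.
move=> b0 h; apply: ge_sup; first by case: (opnorm_has_sup A).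
move=> _ [u /= u1 <-]; set v := A *m u.
have [->|v0] := eqVneq v 0; first by rewrite norm20.
have vp : 0 < norm2 v by rewrite lt_neqAle eq_sym norm2_eq0 v0 norm2_ge0.
have := h ((norm2 v)^-1 *: v) u; rewrite -/v dotvZl -sqr_norm2 expr2 mulKf ?gt_eqF//.
by apply => //; rewrite norm2Z ger0_norm ?invr_ge0 ?norm2_ge0// mulVf// gt_eqF.
Qed.

Lemma dotv_mulmx_le_opnorm A u : norm2 u <= 1 -> dotv u (A *m u) <= opnorm A.
Proof.
move=> u1; apply: le_trans (dotv_norm2_le _ _) _.
apply: le_trans (ler_pM (norm2_ge0 _) (norm2_ge0 _) u1 (norm2_mulmx_le_opnorm A u)) _.
by rewrite mul1r ler_piMr ?opnorm_ge0.
Qed.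

(** Reduces the operator norm to countably many vectors, which makes its sublevel events
    measurable. *)
Lemma opnorm_le_rat A b : 0 <= b ->
  (forall q : 'cV[rat]_d, norm2 (A *m map_mx ratr q) <= b * norm2 (map_mx ratr q)) ->
  opnorm A <= b.
Proof.
move=> b0 h; apply: opnorm_le => // u.
have [F F0 AF] := norm2_mulmx_bounded A.
apply/ler_addgt0Pr => e e0.
(* Chosen so that [(F + b) * (dl * d)] is at most [e]; the added units keep the denominator positive
   when [F + b] or [d] vanishes. *)
pose dl := e / ((F + b + 1) * d.+1%:R).
have Fb : 0 < F + b + 1 by lra.
have dl0 : 0 < dl by rewrite divr_gt0// mulr_gt0.
have dense j : exists q : rat, `|u j 0 - ratr q| < dl.
  have [|q] := @rat_in_itvoo R (u j 0 - dl) (u j 0 + dl); first by lra.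
  rewrite in_itv/= => /andP[q1 q2]; exists q; rewrite ltr_norml; lra.
have /choice[q qP] := dense.
pose Q := map_mx (@ratr R) (\col_j q j).
have uQ : norm2 (u - Q) <= dl * d%:R.
  apply: le_trans (norm2_le_sum _) _.
  rewrite mulr_natr -[d in leRHS]card_ord -sumr_const; apply: ler_sum => j _.
  by rewrite !mxE ltW.
have h1 : norm2 (A *m u) <= norm2 (A *m Q) + norm2 (A *m (u - Q)).
  by rewrite {1}(_ : u = Q + (u - Q)) ?mulmxDr ?ler_norm2D// addrC subrK.
have h2 : norm2 Q <= norm2 u + norm2 (u - Q).
  rewrite {1}(_ : Q = u + (-1) *: (u - Q)); last by rewrite scaleN1r opprB addrC subrK.
  by apply: le_trans (ler_norm2D _ _) _; rewrite norm2Z normrN1 mul1r.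
have h3 := h (\col_j q j); rewrite -/Q in h3.
have h4 := AF (u - Q).
have h5 : (F + b) * norm2 (u - Q) <= e.
  apply: le_trans (ler_wpM2l _ uQ) _; first by lra.
  rewrite /dl -[leRHS]mul1r.
  have -> : (F + b) * (e / ((F + b + 1) * d.+1%:R) * d%:R) =
    ((F + b) / (F + b + 1)) * (d%:R / d.+1%:R) * e.
    by field; rewrite gt_eqF ?ltr0n//= gt_eqF.
  rewrite ler_wpM2r ?(ltW e0)// mulr_ile1 ?divr_ge0//; try lra.
    by rewrite ler_pdivrMr//; lra.
  by rewrite ler_pdivrMr ?ltr0n// mul1r ler_nat.
have := ler_wpM2l b0 h2; lra.
Qed.

End euclidean_theory.

Lemma measurable_opnorm_le {R : realType} {d : nat} disp (T : measurableType disp) (M : T -> 'M[R]_d) (b : R) :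
    (forall i j, measurable_fun [set: T] (fun w => M w i j)) -> 0 <= b ->
  measurable [set w | opnorm (M w) <= b].
Proof.
move=> mM b0.
rewrite (_ : [set w | _] = \bigcap_(q : 'cV[rat]_d)
    [set w | norm2 (M w *m map_mx ratr q) <= b * norm2 (map_mx ratr q)]); last first.
  apply/seteqP; split => w /= h; last by apply: opnorm_le_rat => // q; exact: h.
  move=> q _ /=; apply: le_trans (norm2_mulmx_le_opnorm _ _) _.
  by rewrite ler_wpM2r ?norm2_ge0.
rewrite -[X in measurable X]setCK setC_bigcap; apply: measurableC.
apply: countable_bigcupT_measurable; first exact: countableP.
move=> q; apply: measurableC.
have mq : measurable_fun [set: T] (fun w => norm2 (M w *m map_mx ratr q)).
  have msqrt : measurable_fun [set: R] (@Num.sqrt R).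
    by apply: continuous_measurable_fun => x; exact: sqrt_continuous.
  apply: (measurableT_comp msqrt).
  under eq_fun do rewrite dotvE.
  apply: measurable_sum => i; under eq_fun do rewrite mxE.
  apply: measurable_funM; apply: measurable_sum => j; exact: measurable_funM.
rewrite (_ : [set w | _] = (fun w => norm2 (M w *m map_mx ratr q)) @^-1`
    `]-oo, b * norm2 (map_mx ratr q)]%classic).
  by rewrite -[X in measurable X]setTI; exact: mq.
by apply/seteqP; split => w /=; rewrite in_itv.
Qed.

(** * Moments of a subexponential vector *)

Section moments.
Context {R : realType} {d0 : measure_display} {T0 : measurableType d0}
  (P0 : probability T0 R).
Local Open Scope ereal_scope.

(** Term by term in the exponential series: since [i ^ i / i!] is at most [4 ^ i], the term of index
    [i] integrates to at most [(4 * gam * m) ^ i], hence to at most [2 ^ - i]. *)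
Lemma integral_expR_le2 (X : T0 -> R) (m gam : R) :
    measurable_fun [set: T0] X ->
    (forall k, (0 < k)%N -> \int[P0]_w (`|X w| ^+ k)%:E <= ((k%:R * m) ^+ k)%:E) ->
    (0 <= m)%R -> (0 <= gam)%R -> (8 * (gam * m) <= 1)%R ->
  \int[P0]_w (expR (gam * `|X w|))%:E <= 2%:E.
Proof.
move=> mX Xk m0 g0 gm.
have mXk k : measurable_fun [set: T0] (fun w => `|X w| ^+ k)%R.
  by apply: measurable_funX; exact: measurableT_comp.
pose S n w : R := series (exp_coeff (gam * `|X w|)) n.
have SE n w : S n w = (\sum_(i < n) gam ^+ i / i`!%:R * `|X w| ^+ i)%R.
  rewrite /S /series/= big_mkord; apply: eq_bigr => i _.
  by rewrite /exp_coeff/= exprMn mulrAC.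
have c0 i : (0 <= gam ^+ i / i`!%:R)%R by rewrite divr_ge0// exprn_ge0.
have mS n : measurable_fun [set: T0] (S n).
  rewrite (_ : S n = fun w => \sum_(i < n) gam ^+ i / i`!%:R * `|X w| ^+ i)%R; last first.
    by apply/funext => w; exact: SE.
  by apply: measurable_sum => i; exact: measurable_funM.
have ScvgE w : (S n w)%:E @[n --> \oo] --> (expR (gam * `|X w|))%:E.
  apply: cvg_EFin; first exact: nearW.
  exact: is_cvg_series_exp_coeff.
have l : \int[P0]_w (S n w)%:E @[n --> \oo] --> \int[P0]_w (expR (gam * `|X w|))%:E.
  rewrite (_ : (fun w => (expR (gam * `|X w|))%:E) =
      (fun w => limn (fun n => (S n w)%:E))); last first.
    by apply/funext => w; apply/esym/cvg_lim.
  apply: cvg_monotone_convergence => //.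
  - by move=> n; exact/measurable_EFinP.
  - by move=> n w _; rewrite lee_fin SE sumr_ge0// => i _; rewrite mulr_ge0// exprn_ge0.
  - move=> w _; apply/nondecreasing_seqP => n; rewrite lee_fin !SE big_ord_recr/=.
    by rewrite lerDl mulr_ge0// exprn_ge0.
rewrite -(cvg_lim _ l)//; apply: lime_le; first by apply: cvgP l.
apply: nearW => n; under eq_integral do rewrite SE -sumEFin.
rewrite ge0_integral_sum//; last 2 first.
- by move=> i; apply/measurable_EFinP; exact: measurable_funM.
- by move=> i w _; rewrite lee_fin mulr_ge0// exprn_ge0.
apply: (@le_trans _ _ (\sum_(i < n) ((1 / 2) ^+ i)%:E)); last first.
  rewrite sumEFin lee_fin.
  have : (1 - 1 / 2 : R)%R != 0%R by apply/eqP; lra.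
  elim: n => [|n IH]; first by rewrite big_ord0.
  suff : (\sum_(i < n.+1) (1 / 2 : R) ^+ i = 2 - 2 * (1 / 2) ^+ n.+1)%R.
    by move=> ->; rewrite gerBl mulr_ge0// exprn_ge0//; lra.
  elim: {IH} n => [|n IH]; first by rewrite big_ord1 expr0 expr1; field.
  by rewrite big_ord_recr/= IH !exprS; field.
apply: lee_sum => i _.
rewrite ge0_integralZl_real//.
(* The moment hypothesis starts at exponent 1; the constant term is the total mass. *)
have [->|i0] := eqVneq (i : nat) 0%N.
  under eq_integral do rewrite expr0.
  by rewrite integral_cst// !expr0 fact0 divr1 !mul1e; exact: probability_le1.
rewrite -lt0n in i0.
apply: (@le_trans _ _ ((gam ^+ i / i`!%:R)%:E * ((i%:R * m) ^+ i)%:E)).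
  by apply: lee_wpmul2l; [rewrite lee_fin|exact: Xk].
rewrite -EFinM lee_fin.
have e4 : (expR (1 : R)%R <= 4)%R by have := expR_le_quad (lexx (1 : R)%R); lra.
have ii : (i%:R ^+ i / i`!%:R <= 4 ^+ i :> R)%R.
  have := expR_ge1Dxn i.-1 (ler0n R i); rewrite prednK//.
  have -> : expR i%:R = (expR (1 : R) ^+ i)%R by rewrite -expRM_natr mul1r.
  have : (expR (1 : R) ^+ i <= 4 ^+ i)%R by rewrite lerXn2r ?nnegrE ?expR_ge0.
  lra.
have -> : (gam ^+ i / i`!%:R * (i%:R * m) ^+ i = (gam * m) ^+ i * (i%:R ^+ i / i`!%:R))%R.
  by rewrite !exprMn; ring.
apply: (@le_trans _ _ ((gam * m) ^+ i * 4 ^+ i)%R).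
  by rewrite ler_wpM2l// exprn_ge0// mulr_ge0.
rewrite -exprMn lerXn2r ?nnegrE ?mulr_ge0//; lra.
Qed.

End moments.

Section borel_vectors.
Context {R : realType} {d : nat}.

Lemma measurable_coord (j : 'I_d) :
  measurable_fun [set: borel_cV R d] (fun z : borel_cV R d => (z : 'cV[R]_d) j 0).
Proof.
apply: (measurability _ (RGenOpens.measurableE R)).
move=> _ [_ [a [b ->] <-]]; rewrite setTI; apply: sub_sigma_algebra.
by apply: open_comp; [move=> z _; exact: coord_continuous | exact: interval_open].
Qed.

Lemma measurable_dotv (u : 'cV[R]_d) :
  measurable_fun [set: borel_cV R d] (fun z : borel_cV R d => dotv u z).
Proof.
under eq_fun do rewrite dotvE.
apply: measurable_sum => j; apply: measurable_funM => //; exact: measurable_coord.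
Qed.

Lemma measurable_dotvv :
  measurable_fun [set: borel_cV R d] (fun z : borel_cV R d => dotv (z : 'cV[R]_d) z).
Proof.
under eq_fun do rewrite dotvE.
apply: measurable_sum => j; apply: measurable_funM => //; exact: measurable_coord.
Qed.

End borel_vectors.

Section subexponential_vector.
Context {R : realType} {d : nat} {d0 : measure_display} {T0 : measurableType d0}
  (P0 : probability T0 R) (Z : {RV P0 >-> borel_cV R d}).
Variables (Sigma : 'M[R]_d) (eta : R).
Hypothesis cov : has_mean P0 (fun w => (Z w : 'cV[R]_d) *m (Z w : 'cV[R]_d)^T) Sigma.
Hypothesis eta1 : 1 <= eta.
Hypothesis moment : forall (u : 'cV[R]_d) (p : R), 1 <= p ->
  ('N[P0]_p%:E[(fun w => (dotv u (Z w))%:E)] <= (eta * p * normS Sigma u)%:E)%E.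

Let mZ : measurable_fun [set: T0] Z. Proof. exact: measurable_funPT. Qed.

Lemma measurable_dotvZ u : measurable_fun [set: T0] (fun w => dotv u (Z w)).
Proof. exact: (measurableT_comp (measurable_dotv u) mZ). Qed.

Lemma normS_ge0 (u : 'cV[R]_d) : 0 <= normS Sigma u. Proof. exact: sqrtr_ge0. Qed.

Lemma integral_norm_exp_le u k : (0 < k)%N ->
  (\int[P0]_w (`|dotv u (Z w)| ^+ k)%:E <= ((k%:R * (eta * normS Sigma u)) ^+ k)%:E)%E.
Proof.
move=> k0; have k1 : (1 <= k%:R :> R) by rewrite ler1n.
have kn0 : k%:R != 0 :> R by rewrite pnatr_eq0 -lt0n.
have := poweR_Lnorm P0 (fun w => (dotv u (Z w))%:E) kn0.
under eq_integral do rewrite abse_EFin poweR_EFin powR_mulrn//.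
move=> <-; have := moment u k1.
have N0 := Lnorm_ge0 P0 k%:R%:E (fun w => (dotv u (Z w))%:E).
(* The infinite values of the norm contradict its finite bounds. *)
move: N0; case: (Lnorm _ _ _) => [x|//|//]; rewrite !lee_fin => x0 xle.
rewrite powR_mulrn// lerXn2r ?nnegrE// mulrCA mulrA//.
exact: le_trans x0 xle.
Qed.

(** The second moments of the coordinates are finite by the moment hypothesis, so products of
    coordinates are integrable and the double sum may leave the integral. *)
Lemma integral_dotv_mul u v :
  (\int[P0]_w (dotv u (Z w) * dotv v (Z w))%:E = (dotv u (Sigma *m v))%:E)%E.
Proof.
have mc j : measurable_fun [set: T0] (fun w => (Z w : 'cV[R]_d) j 0).
  exact: (measurableT_comp (measurable_coord j) mZ).
have sq j : P0.-integrable [set: T0] (fun w => (((Z w : 'cV[R]_d) j 0) ^+ 2)%:E).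
  apply/integrableP; split; first by apply/measurable_EFinP; exact: measurable_funX.
  have := integral_norm_exp_le (delta_mx j 0) (k := 2) isT.
  under eq_integral => w _.
    rewrite (_ : dotv _ _ = (Z w : 'cV[R]_d) j 0); last first.
      rewrite dotvE (bigD1 j)//= mxE !eqxx mul1r big1 ?addr0// => i /negbTE ij.
      by rewrite mxE ij mul0r.
    over.
  under [X in _ -> (X < _)%E]eq_integral do rewrite abse_EFin normrX.
  by move=> /le_lt_trans; apply; rewrite ltry.
have pr i j : P0.-integrable [set: T0]
    (fun w => ((Z w : 'cV[R]_d) i 0 * (Z w : 'cV[R]_d) j 0)%:E).
  apply: (le_integrable measurableT _ _ (integrableD measurableT (sq i) (sq j))).
    by apply/measurable_EFinP; exact: measurable_funM.
  move=> w _ /=; rewrite lee_fin normrM [leRHS]ger0_norm ?addr_ge0 ?sqr_ge0//.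
  rewrite -(real_normK (num_real (_ i 0))) -(real_normK (num_real (_ j 0))).
  set a := `|_|; set b := `|_|; have := sqr_ge0 (a - b); have := sqr_ge0 a; have := sqr_ge0 b; nra.
have E i j : (\int[P0]_w ((Z w : 'cV[R]_d) i 0 * (Z w : 'cV[R]_d) j 0)%:E = (Sigma i j)%:E)%E.
  rewrite -cov unlock; apply: eq_integral => w _; congr EFin.
  by rewrite mxE big_ord1 mxE.
transitivity (\int[P0]_w \sum_i \sum_j (u i 0 * v j 0)%:E *
    ((Z w : 'cV[R]_d) i 0 * (Z w : 'cV[R]_d) j 0)%:E)%E.
  apply: eq_integral => w _; rewrite !dotvE mulr_suml -sumEFin; apply: eq_bigr => i _.
  rewrite mulr_sumr -sumEFin; apply: eq_bigr => j _; rewrite -EFinM; congr EFin; ring.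
rewrite integral_sum//; last first.
  by move=> i; apply: integrable_sum => // j _; exact: integrableZl.
rewrite dotvE -sumEFin; apply: eq_bigr => i _.
rewrite integral_sum//; last by move=> j; exact: integrableZl.
rewrite mxE mulr_sumr -sumEFin; apply: eq_bigr => j _.
by rewrite integralZl// E -EFinM; congr EFin; ring.
Qed.

Lemma quad_ge0 u : 0 <= dotv u (Sigma *m u).
Proof.
rewrite -lee_fin -integral_dotv_mul; apply: integral_ge0 => w _.
by rewrite lee_fin -expr2 sqr_ge0.
Qed.

Lemma sqr_normS u : normS Sigma u ^+ 2 = dotv u (Sigma *m u).
Proof. by rewrite /normS -mulmxA sqr_sqrtr//; exact: quad_ge0. Qed.

Lemma trace_cov_ge0 : 0 <= \tr Sigma.
Proof.
apply: sumr_ge0 => j _; have := quad_ge0 (delta_mx j 0).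
by rewrite -colE dotvE (bigD1 j)//= !mxE !eqxx mul1r big1 ?addr0// => i /negbTE ij; rewrite mxE ij mul0r.
Qed.

Let m4 u : measurable_fun [set: T0] (fun w => dotv u (Z w) ^+ 4).
Proof. by apply: measurable_funX; exact: measurable_dotvZ. Qed.

Lemma integral_dotv4_le u :
  (\int[P0]_w (dotv u (Z w) ^+ 4)%:E <= (256 * eta ^+ 4 * (dotv u (Sigma *m u)) ^+ 2)%:E)%E.
Proof.
have := integral_norm_exp_le u (k := 4) isT.
under eq_integral do rewrite -normrX ger0_norm ?exprn_even_ge0//.
move=> /le_trans; apply; rewrite lee_fin -sqr_normS.
by rewrite le_eqVlt; apply/orP; left; apply/eqP; ring.
Qed.

(* The regularization [e] makes the AM-GM weights legitimate for degenerate
   directions, where [dotv u (Sigma *m u) = 0]. *)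
Lemma integral_dotv_sqr_mul_le u v (e : R) : 0 < e ->
  (\int[P0]_w ((dotv u (Z w) * dotv v (Z w)) ^+ 2)%:E <=
   (256 * eta ^+ 4 * ((dotv u (Sigma *m u) + e) * (dotv v (Sigma *m v) + e)))%:E)%E.
Proof.
move=> e0.
set a := dotv u (Sigma *m u); set b := dotv v (Sigma *m v).
have a0 : 0 <= a := quad_ge0 u. have b0 : 0 <= b := quad_ge0 v.
have ae : 0 < a + e by lra. have be : 0 < b + e by lra.
have E4 : 0 <= eta ^+ 4 by rewrite exprn_even_ge0.
pose s := (b + e) / (a + e) / 2; pose r := (a + e) / (b + e) / 2.
have s0 : 0 <= s by rewrite !divr_ge0// ltW.
have r0 : 0 <= r by rewrite !divr_ge0// ltW.
apply: (@le_trans _ _ (\int[P0]_w (s * dotv u (Z w) ^+ 4 + r * dotv v (Z w) ^+ 4)%:E)%E).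
  apply: ge0_le_integral => //.
  - by move=> w _; rewrite lee_fin sqr_ge0.
  - apply/measurable_EFinP; apply: measurable_funX.
    by apply: measurable_funM; exact: measurable_dotvZ.
  - by apply/measurable_EFinP; apply: measurable_funD; exact: measurable_funM.
  move=> w _; rewrite lee_fin; set x := dotv u _; set y := dotv v _.
  rewrite -subr_ge0.
  rewrite (_ : _ - _ = ((b + e) * x ^+ 2 - (a + e) * y ^+ 2) ^+ 2 / (2 * (a + e) * (b + e))).
    by rewrite divr_ge0 ?sqr_ge0// ltW// !mulr_gt0.
  by rewrite /s /r; field; rewrite !gt_eqF.
under eq_integral do rewrite EFinD.
rewrite ge0_integralD//; last 4 first.
- by move=> w _; rewrite lee_fin mulr_ge0// exprn_even_ge0.
- by apply/measurable_EFinP; exact: measurable_funM.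
- by move=> w _; rewrite lee_fin mulr_ge0// exprn_even_ge0.
- by apply/measurable_EFinP; exact: measurable_funM.
rewrite !ge0_integralZl_real//; try by move=> w; rewrite exprn_even_ge0.
have s0' : (0 <= s%:E)%E by rewrite lee_fin.
have r0' : (0 <= r%:E)%E by rewrite lee_fin.
apply: le_trans (leeD (lee_wpmul2l s0' (integral_dotv4_le u)) (lee_wpmul2l r0' (integral_dotv4_le v))) _.
rewrite -!EFinM -EFinD lee_fin -/a -/b.
apply: (@le_trans _ _ (s * (256 * eta ^+ 4 * (a + e) ^+ 2) + r * (256 * eta ^+ 4 * (b + e) ^+ 2))).
  have sqD x : 0 <= x -> 256 * eta ^+ 4 * x ^+ 2 <= 256 * eta ^+ 4 * (x + e) ^+ 2.
    by move=> x0; apply: ler_wpM2l; [rewrite mulr_ge0|nra].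
  by apply: lerD; [apply: (ler_wpM2l s0)|apply: (ler_wpM2l r0)]; exact: sqD.
by rewrite le_eqVlt; apply/orP; left; apply/eqP; rewrite /s /r; field; rewrite !gt_eqF.
Qed.

Lemma integral_expR_dotv_le2 u (gam : R) : 0 <= gam ->
    8 * (gam * (eta * normS Sigma u)) <= 1 ->
  (\int[P0]_w (expR (gam * `|dotv u (Z w)|))%:E <= 2%:E)%E.
Proof.
move=> g0 h; apply: integral_expR_le2 h => //; first exact: measurable_dotvZ.
  by move=> k k0; exact: integral_norm_exp_le.
by rewrite mulr_ge0 ?normS_ge0// (le_trans ler01 eta1).
Qed.

(** The square of [dotv Z Z] is a double sum of squared products of coordinates. With the
    regularization [e = b / d], the bounds add up to the square of [\tr Sigma + b], free of the
    dimension. *)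
Lemma integral_sqnorm2_le b : (0 < d)%N -> 0 < b -> \tr Sigma <= b ->
  (\int[P0]_w (dotv (Z w) (Z w) ^+ 2)%:E <= (1024 * eta ^+ 4 * b ^+ 2)%:E)%E.
Proof.
move=> dp b0 trb; pose e := b / d%:R.
have e0 : 0 < e by rewrite divr_gt0// ltr0n.
pose dl j : 'cV[R]_d := delta_mx j 0.
have dZ j (z : 'cV[R]_d) : dotv (dl j) z = z j 0.
  rewrite dotvE (bigD1 j)//= mxE !eqxx mul1r big1 ?addr0// => i /negbTE ij.
  by rewrite mxE ij mul0r.
rewrite (_ : (fun w => _) = (fun w =>
    \sum_i \sum_j ((dotv (dl i) (Z w) * dotv (dl j) (Z w)) ^+ 2)%:E)%E); last first.
  apply/funext => w; rewrite [X in X ^+ 2]dotvE expr2 mulr_suml -sumEFin.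
  apply: eq_bigr => i _; rewrite mulr_sumr -sumEFin; apply: eq_bigr => j _.
  by rewrite !dZ; congr EFin; ring.
have m2 i j : measurable_fun [set: T0] (fun w => ((dotv (dl i) (Z w) * dotv (dl j) (Z w)) ^+ 2)%:E).
  apply/measurable_EFinP; apply: measurable_funX.
  by apply: measurable_funM; exact: measurable_dotvZ.
rewrite ge0_integral_sum//; last 2 first.
- by move=> i; apply: emeasurable_sum => j.
- by move=> i w _; apply: sume_ge0 => j _; rewrite lee_fin sqr_ge0.
apply: (@le_trans _ _ (\sum_i \sum_j (256 * eta ^+ 4 * ((Sigma i i + e) * (Sigma j j + e)))%:E)%E).
  apply: lee_sum => i _; rewrite ge0_integral_sum//; last first.
    by move=> j w _; rewrite lee_fin sqr_ge0.
  apply: lee_sum => j _; apply: le_trans (integral_dotv_sqr_mul_le _ _ e0) _.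
  by rewrite !dZ -!colE !mxE.
under eq_bigr do rewrite sumEFin.
rewrite sumEFin lee_fin.
have trE : \sum_i (Sigma i i + e) = \tr Sigma + b.
  rewrite big_split /= sumr_const card_ord -[in LHS]mulr_natr /e.
  by rewrite /mxtrace divfK ?pnatr_eq0 -?lt0n.
under eq_bigr do rewrite -mulr_sumr -mulr_sumr.
rewrite -mulr_sumr -mulr_suml trE.
have tr0 := trace_cov_ge0; have E4 : 0 <= eta ^+ 4 by rewrite exprn_even_ge0.
have -> : 1024 * eta ^+ 4 * b ^+ 2 = 256 * eta ^+ 4 * ((2 * b) * (2 * b)) by ring.
apply: ler_wpM2l; first by rewrite mulr_ge0.
by apply: ler_pM; lra.
Qed.

End subexponential_vector.

(** * Randomized vectors *)

Section randomized_vectors.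
Context {R : realType} {d K : nat}.
Hypothesis K0 : (0 < K)%N.
Implicit Types (u z : 'cV[R]_d) (th : {ffun 'I_d * 'I_K -> bool}).

(* For [th] distributed as [tilt (bias u)], the vector [rvec th] has mean [u],
   and its coordinates are independent with variance at most [4 / K]. *)
Definition rvec th : 'cV[R]_d := \col_j (2 / K%:R * \sum_k sg (th (j, k))).

(** Halving keeps biases within 1/2 on the unit ball: log-densities stay finite, and each sign keeps
    variance at least 3/4, as the lower bound [tE_dotv_sqr_ge] needs. The factor 2 in [rvec]
    restores the mean. *)
Definition bias u (p : 'I_d * 'I_K) : R := u p.1 0 / 2.

Let cf z (p : 'I_d * 'I_K) : R := 2 / K%:R * z p.1 0.

(** The variance of [dotv (rvec th) z] under unbiased signs; under any [bias u] with [norm2 u <= 1]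
    it lies between three quarters of this and this. It does not involve [u]. *)
Definition sig2 z : R := 4 / K%:R * dotv z z.

Let Kn0 : K%:R != 0 :> R. Proof. by rewrite pnatr_eq0 -lt0n. Qed.

Let sum_cst (x : R) : \sum_(k < K) x = K%:R * x.
Proof. by rewrite sumr_const card_ord mulr_natl. Qed.

Let pairE (F : 'I_d * 'I_K -> R) : \sum_p F p = \sum_j \sum_k F (j, k).
Proof. by rewrite pair_bigA; apply: eq_bigr => -[]. Qed.

Lemma bias_lt1 u p : norm2 u <= 1 -> `|bias u p| < 1.
Proof.
move=> u1.
have : u p.1 0 ^+ 2 <= 1.
  apply: (@le_trans _ _ (norm2 u ^+ 2)); last by rewrite exprn_ile1// norm2_ge0.
  rewrite sqr_norm2 dotvE (bigD1 p.1)//= -expr2 lerDl.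
  by apply: sumr_ge0 => j _; rewrite -expr2 sqr_ge0.
by rewrite /bias ltr_norml => h; apply/andP; split; nra.
Qed.

Lemma bias_le1 u p : norm2 u <= 1 -> `|bias u p| <= 1.
Proof. by move=> u1; rewrite ltW// bias_lt1. Qed.

Let bias_sqr u p : norm2 u <= 1 -> bias u p ^+ 2 <= 1 / 4.
Proof.
move=> u1; have : u p.1 0 ^+ 2 <= 1.
  apply: (@le_trans _ _ (norm2 u ^+ 2)); last by rewrite exprn_ile1// norm2_ge0.
  rewrite sqr_norm2 dotvE (bigD1 p.1)//= -expr2 lerDl.
  by apply: sumr_ge0 => j _; rewrite -expr2 sqr_ge0.
by rewrite /bias; nra.
Qed.

Lemma sum_bias_sqr u : norm2 u <= 1 -> \sum_p bias u p ^+ 2 <= K%:R / 4.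
Proof.
move=> u1; have -> : \sum_p bias u p ^+ 2 = K%:R / 4 * norm2 u ^+ 2.
  rewrite pairE /= sqr_norm2 dotvE mulr_sumr.
  by apply: eq_bigr => j _; rewrite /bias/= sum_cst; field.
by rewrite ler_piMr ?divr_ge0// exprn_ile1// norm2_ge0.
Qed.

Let dotv_rvec th z : dotv (rvec th) z = \sum_p cf z p * sg (th p).
Proof.
rewrite pairE /= dotvE.
by apply: eq_bigr => j _; rewrite mxE mulrAC mulr_sumr.
Qed.

Let sum_cf_bias u z : \sum_p cf z p * bias u p = dotv u z.
Proof.
rewrite pairE /= dotvE.
by apply: eq_bigr => j _; rewrite /cf /bias/= sum_cst; field.
Qed.

Let sum_cf_sqr z : \sum_p cf z p ^+ 2 = sig2 z.
Proof.
rewrite pairE /= /sig2 dotvE mulr_sumr.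
by apply: eq_bigr => j _; rewrite /cf/= sum_cst; field.
Qed.

Lemma sig2_ge0 z : 0 <= sig2 z.
Proof. by rewrite mulr_ge0 ?divr_ge0// dotvv_ge0. Qed.

Lemma tE_dotv_rvec u z : tE (bias u) (fun th => dotv (rvec th) z) = dotv u z.
Proof. by rewrite (tE_eq _ (G := fun th => \sum_p cf z p * sg (th p))) ?tE_linear. Qed.

Let tE_dotv_sqr u z : tE (bias u) (fun th => dotv (rvec th) z ^+ 2) =
  dotv u z ^+ 2 + \sum_p cf z p ^+ 2 * (1 - bias u p ^+ 2).
Proof.
rewrite (tE_eq _ (G := fun th => \sum_p \sum_p' (cf z p * cf z p') * (sg (th p) * sg (th p')))).
  rewrite tE_bilinear; congr (_ + _).
  rewrite -sum_cf_bias expr2 mulr_suml; apply: eq_bigr => p _.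
  by rewrite mulr_sumr; apply: eq_bigr => p' _; ring.
move=> th; rewrite dotv_rvec expr2 mulr_suml; apply: eq_bigr => p _.
by rewrite mulr_sumr; apply: eq_bigr => p' _; ring.
Qed.

Lemma tE_dotv_sqr_le u z : norm2 u <= 1 ->
  tE (bias u) (fun th => dotv (rvec th) z ^+ 2) <= dotv u z ^+ 2 + sig2 z.
Proof.
move=> u1; rewrite tE_dotv_sqr lerD2l -sum_cf_sqr; apply: ler_sum => p _.
have := sqr_ge0 (cf z p); have := sqr_ge0 (bias u p); nra.
Qed.

Lemma tE_dotv_sqr_ge u z : norm2 u <= 1 ->
  3 / 4 * (dotv u z ^+ 2 + sig2 z) <= tE (bias u) (fun th => dotv (rvec th) z ^+ 2).
Proof.
move=> u1; rewrite tE_dotv_sqr mulrDr; apply: lerD.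
  have := sqr_ge0 (dotv u z); lra.
rewrite -sum_cf_sqr mulr_sumr; apply: ler_sum => p _.
have := sqr_ge0 (cf z p); have := bias_sqr p u1; nra.
Qed.

Lemma tE_noise4_rvec u z : norm2 u <= 1 ->
  tE (bias u) (fun th => (dotv (rvec th) z - dotv u z) ^+ 4) <= kurt * sig2 z ^+ 2.
Proof.
move=> u1; rewrite -sum_cf_sqr.
have := tE_noise4 (cf z) (fun p => bias_le1 p u1).
apply: le_trans; apply: ler_tE => [p|th]; first exact: bias_le1.
rewrite dotv_rvec -sum_cf_bias -sumrB.
by under eq_bigr do rewrite -mulrBr.
Qed.

Lemma tE_dotv4_le u z : norm2 u <= 1 ->
  tE (bias u) (fun th => dotv (rvec th) z ^+ 4) <= 8 * kurt * (dotv u z ^+ 2 + sig2 z) ^+ 2.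
Proof.
move=> u1; set a := dotv u z; set s := sig2 z.
apply: (@le_trans _ _ (tE (bias u) (fun th => 8 * a ^+ 4 + 8 * (dotv (rvec th) z - a) ^+ 4))).
  apply: ler_tE => [p|th]; first exact: bias_le1.
  set x := dotv _ _; set b := x - a.
  have -> : x ^+ 4 = (x ^+ 2) ^+ 2 by rewrite -exprM.
  have -> : a ^+ 4 = (a ^+ 2) ^+ 2 by rewrite -exprM.
  have -> : b ^+ 4 = (b ^+ 2) ^+ 2 by rewrite -exprM.
  have h1 : x ^+ 2 <= 2 * (a ^+ 2 + b ^+ 2).
    by rewrite /b; have := sqr_ge0 (x - 2 * a); nra.
  have : (x ^+ 2) ^+ 2 <= (2 * (a ^+ 2 + b ^+ 2)) ^+ 2.
    have h0 := sqr_ge0 x; rewrite -subr_ge0 subr_sqr mulr_ge0//; lra.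
  have := sqr_ge0 (a ^+ 2 - b ^+ 2); nra.
rewrite tED tE_cst tEZ.
have h8 : 0 <= 8 :> R by [].
apply: le_trans (lerD (lexx _) (ler_wpM2l h8 (tE_noise4_rvec z u1))) _.
rewrite -/s; have k1 := @kurt_ge1 R; move: kurt k1 => M M1.
have s0 : 0 <= s := sig2_ge0 z.
have a0 : 0 <= a ^+ 2 := sqr_ge0 a.
have -> : a ^+ 4 = (a ^+ 2) ^+ 2 by rewrite -exprM.
move: (a ^+ 2) a0 => b b0; rewrite -subr_ge0.
have -> : 8 * M * (b + s) ^+ 2 - (8 * b ^+ 2 + 8 * (M * s ^+ 2)) =
  8 * ((M - 1) * b ^+ 2) + 16 * (M * (b * s)) by ring.
have M0 : 0 <= M by lra.
by rewrite addr_ge0// mulr_ge0// mulr_ge0// ?subr_ge0 ?sqr_ge0// mulr_ge0.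
Qed.

(** Only the diagonal pairs of signs depart from the product of means. Each adds at most
    [4 / K ^+ 2] times [S j j], and there are [K] of them per coordinate. *)
Lemma tE_quad_rvec u (S : 'M[R]_d) : norm2 u <= 1 -> (forall j, 0 <= S j j) ->
  tE (bias u) (fun th => dotv (rvec th) (S *m rvec th)) <=
  dotv u (S *m u) + 4 / K%:R * \tr S.
Proof.
move=> u1 S0.
pose rw j : 'cV[R]_d := (row j S)^T.
have rwE j v : dotv v (rw j) = (S *m v) j 0.
  by rewrite dotvC dotvE mxE; apply: eq_bigr => i _; rewrite !mxE.
pose q (p p' : 'I_d * 'I_K) : R := 2 / K%:R * cf (rw p.1) p'.
rewrite (tE_eq _ (G := fun th => \sum_p \sum_p' q p p' * (sg (th p) * sg (th p')))); last first.
  move=> th; rewrite dotv_rvec; apply: eq_bigr => p _.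
  rewrite /cf -rwE dotv_rvec mulr_sumr mulr_suml; apply: eq_bigr => p' _.
  by rewrite /q; ring.
rewrite tE_bilinear; apply: lerD.
  rewrite -sum_cf_bias le_eqVlt; apply/orP; left; apply/eqP; apply: eq_bigr => p _.
  rewrite /cf -rwE -sum_cf_bias mulr_sumr mulr_suml; apply: eq_bigr => p' _.
  by rewrite /q; ring.
apply: (@le_trans _ _ (\sum_(p : 'I_d * 'I_K) (2 / K%:R) ^+ 2 * S p.1 p.1)).
  apply: ler_sum => p _; rewrite /q /cf !mxE mulrA -expr2 ler_piMr//.
    by rewrite mulr_ge0 ?sqr_ge0.
  by have := sqr_ge0 (bias u p); lra.
rewrite pairE /= /mxtrace mulr_sumr.
by apply: ler_sum => j _; rewrite sum_cst le_eqVlt; apply/orP; left; apply/eqP; field.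
Qed.

End randomized_vectors.

Arguments sig2 {R d} K z.

(** * Clipping, excess and lower bounds of Khintchine type *)

Section truncation.
Context {R : realType} {d K : nat}.
Hypothesis K0 : (0 < K)%N.
Implicit Types (u z : 'cV[R]_d) (th : {ffun 'I_d * 'I_K -> bool}).

(** A constant of Paley-Zygmund type, small enough for the fourth-moment term in [tE_trunc_ge] to be
    absorbed. *)
Definition pzc : R := (32 * kurt)^-1.

Lemma pzc_gt0 : 0 < pzc.
Proof. by have := @kurt_ge1 R; rewrite invr_gt0; lra. Qed.

Lemma pzc_kurt : 32 * kurt * pzc = 1.
Proof. by have := @kurt_ge1 R => k1; rewrite divff// gt_eqF//; lra. Qed.

Lemma pzc_le : pzc <= 1 / 32.
Proof.
have := @kurt_ge1 R => k1; rewrite /pzc div1r lef_pV2 ?posrE; lra.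
Qed.

(* Khintchine: [X := dotv (rvec th) z] has second moment of order [A^2] and
   fourth moment at most a constant times [A^4], so that taking expectations in
   [|X| >= h X^2 / A - h^3 X^4 / A^3] with [h = 8 pzc] bounds [E |X|] from below
   by a multiple of [A].  AM-GM disposes of the event where [good] fails. *)
Lemma tE_trunc_ge u z (A tau : R) (good : {ffun 'I_d * 'I_K -> bool} -> bool) :
    norm2 u <= 1 -> 0 <= A -> A ^+ 2 = dotv u z ^+ 2 + sig2 K z -> 0 <= tau ->
    tE (bias u) (fun th => (~~ good th)%:R) <= pzc ^+ 2 ->
  pzc * A - tau <= tE (bias u)
    (fun th => if good th then Num.max 0 (`|dotv (rvec th) z| - tau) else 0).
Proof.
move=> u1 A0 AE tau0 bad.
have u1' : forall p, `|@bias _ _ K u p| <= 1 by move=> p; exact: bias_le1.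
have [A00|An0] := eqVneq A 0.
  apply: (@le_trans _ _ (tE (@bias _ _ K u) (fun=> 0))).
    by rewrite tE_cst A00 mulr0 sub0r oppr_le0.
  by apply: ler_tE => // th; case: ifP => // _; rewrite le_max lexx.
have {An0}Ap : 0 < A by rewrite lt_neqAle eq_sym An0.
have c0 := pzc_gt0; have ck := pzc_kurt.
move: bad ck c0; set c := pzc => bad ck c0.
have k1 := @kurt_ge1 R; move: (tE_dotv4_le K0 z u1) k1 ck; set M := kurt => X4 M1 cM.
pose B : R := 512 * c ^+ 3 / A ^+ 3.
have cw : 0 <= c by exact: ltW.
have B0 : 0 <= B.
  by apply: divr_ge0; [apply: mulr_ge0; [exact: ler0n|exact: exprn_ge0]|exact: exprn_ge0].
pose D : R := A / (2 * c).
have D0 : 0 <= D by rewrite divr_ge0 ?mulr_ge0.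
(* Of the coefficient [8 * c / A] of [X ^+ 2], the share [c / (2 * A)] is set aside: by AM-GM it
   bounds [|X|], up to [D], where [good] fails. *)
pose C : R := 15 / 2 * c / A.
have C0 : 0 <= C by rewrite divr_ge0 ?mulr_ge0.
apply: (@le_trans _ _ (tE (@bias _ _ K u) (fun th => C * dotv (rvec th) z ^+ 2 +
    ((- B) * dotv (rvec th) z ^+ 4 + (- tau + (- D) * (~~ good th)%:R))))).
  rewrite !tED tE_cst !tEZ.
  have h2 := ler_wpM2l C0 (tE_dotv_sqr_ge K0 z u1).
  have h4 := ler_wpM2l B0 X4.
  have h0 := ler_wpM2l D0 bad.
  rewrite -AE in h2 h4.
  (* In units of [c * A], the second moment gives 45/8, the fourth costs at most 4 and the bad event
     1/2, leaving more than 1. *)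
  have e2 : C * (3 / 4 * A ^+ 2) = 45 / 8 * (c * A) by rewrite /C; field; rewrite gt_eqF.
  have e4 : B * (8 * M * (A ^+ 2) ^+ 2) = 128 * (c * A) * c * (32 * M * c).
    by rewrite /B; field; rewrite gt_eqF.
  have e0 : D * c ^+ 2 = 1 / 2 * (c * A) by rewrite /D; field; rewrite gt_eqF.
  rewrite e2 in h2; rewrite e4 cM mulr1 in h4; rewrite e0 in h0.
  have cA : 0 <= c * A by rewrite mulr_ge0// ltW.
  have c1 : c <= 1 / 32 := pzc_le.
  have : 128 * (c * A) * c <= 4 * (c * A) by nra.
  lra.
apply: ler_tE => // th; move: (dotv (rvec th) z) => X.
have hX : C * X ^+ 2 - B * X ^+ 4 + c / (2 * A) * X ^+ 2 <= `|X|.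
  have -> : X ^+ 4 = `|X| ^+ 4 by rewrite -normrX ger0_norm// exprn_even_ge0.
  rewrite -(real_normK (num_real X)); move: `|X| (normr_ge0 X) => x x0.
  pose y := 8 * c / A * x.
  have y0 : 0 <= y by rewrite mulr_ge0// divr_ge0 ?mulr_ge0.
  have hy : y ^+ 2 - y ^+ 4 <= y.
    have [y1|y1] := leP y 1.
      have : 0 <= y ^+ 4 by rewrite exprn_ge0.
      nra.
    have : 0 <= (y ^+ 2 - 1) * y ^+ 2 by rewrite mulr_ge0 ?sqr_ge0//; nra.
    have -> : y ^+ 4 = y ^+ 2 * y ^+ 2 by rewrite -exprD.
    nra.
  have a0 : 0 <= A / (8 * c) by rewrite divr_ge0 ?mulr_ge0.
  have := ler_wpM2l a0 hy.
  have -> : A / (8 * c) * y = x by rewrite /y; field; rewrite !gt_eqF.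
  apply: le_trans; rewrite le_eqVlt; apply/orP; left; apply/eqP.
  by rewrite /y /C /B; field; rewrite !gt_eqF.
have hD : `|X| <= c / (2 * A) * X ^+ 2 + D.
  rewrite -(real_normK (num_real X)) -subr_ge0 /D.
  rewrite (_ : _ - _ = (c * `|X| - A) ^+ 2 / (2 * c * A)); last by field; rewrite !gt_eqF.
  by rewrite divr_ge0 ?sqr_ge0 ?mulr_ge0.
have hc : 0 <= c / (2 * A) * X ^+ 2 by rewrite mulr_ge0 ?sqr_ge0// divr_ge0 ?mulr_ge0.
case: (good th) => /=.
  have : `|X| - tau <= Num.max 0 (`|X| - tau) by rewrite le_max lexx orbT.
  lra.
lra.
Qed.

Definition big_part (lam a : R) : R := if 1 / 4 < lam * a then lam * a else 0.

(** The cap at 1 provides exponential moments; it is inactive in the regime where [tE_excess_le]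
    uses this part. *)
Definition small_part (lam s : R) : R := Num.min 1 (lam ^+ 2 * s ^+ 2).

(** Above the level 1/4 the second moment is enough. Below it, with [b] the noise, an excess can
    only come from [b]: [lam * X ^+ 2 - 1 <= 2 * lam * b ^+ 2 - 1 / 2], which is at most half the
    square of [2 * lam * b ^+ 2], and the fourth moment of the noise concludes. *)
Lemma tE_excess_le u z (lam : R) : norm2 u <= 1 -> 0 <= lam ->
  tE (bias u) (fun th : {ffun 'I_d * 'I_K -> bool} =>
      Num.max 0 (lam * dotv (rvec th) z ^+ 2 - 1)) <=
  big_part lam (dotv u z ^+ 2 + sig2 K z) + 2 * kurt * small_part lam (sig2 K z).
Proof.
move=> u1 l0; set a := dotv u z; set s := sig2 K z.
have s0 : 0 <= s := sig2_ge0 z.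
have u1' : forall p, `|@bias _ _ K u p| <= 1 by move=> p; exact: bias_le1.
have k1 := @kurt_ge1 R.
have sm0 : 0 <= small_part lam s.
  by rewrite /small_part le_min ler01 mulr_ge0 ?sqr_ge0.
have ksm0 : 0 <= 2 * kurt * small_part lam s by apply: mulr_ge0 => //; lra.
rewrite /big_part; case: ltP => h.
  apply: (@le_trans _ _ (lam * (a ^+ 2 + s))); last by rewrite lerDl.
  apply: le_trans (ler_wpM2l l0 (tE_dotv_sqr_le K0 z u1)).
  rewrite -tEZ; apply: ler_tE => // th; rewrite ge_max gerBl ler01 andbT.
  by rewrite mulr_ge0 ?sqr_ge0.
rewrite add0r; apply: (@le_trans _ _ (2 * lam ^+ 2 * (kurt * s ^+ 2))).
  have l2 : 0 <= 2 * lam ^+ 2 by rewrite mulr_ge0 ?sqr_ge0.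
  apply: le_trans (ler_wpM2l l2 (tE_noise4_rvec K0 z u1)).
  rewrite -tEZ -/a; apply: ler_tE => // th; move: (dotv _ _) => X.
  set b := X - a.
  have hX : X ^+ 2 <= 2 * a ^+ 2 + 2 * b ^+ 2.
    by rewrite /b; have := sqr_ge0 (X - 2 * a); nra.
  have := ler_wpM2l l0 hX => hl.
  have e : 2 * lam ^+ 2 * b ^+ 4 = (2 * lam * b ^+ 2) ^+ 2 / 2 by field.
  have ls : 0 <= lam * s by rewrite mulr_ge0.
  rewrite ge_max e; apply/andP; split; first by rewrite divr_ge0// sqr_ge0.
  have := sqr_ge0 (2 * lam * b ^+ 2 - 1); nra.
rewrite [leRHS](_ : _ = 2 * kurt * (lam ^+ 2 * s ^+ 2)); last first.
  congr (_ * _); rewrite /small_part min_r// -exprMn exprn_ile1//; first by apply: mulr_ge0.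
  have : 0 <= lam * a ^+ 2 by rewrite mulr_ge0 ?sqr_ge0.
  lra.
by rewrite le_eqVlt; apply/orP; left; apply/eqP; ring.
Qed.

(** As [|x * y|] is at most the larger of the two squares, the excess of a product splits into terms
    that see a single randomization each. *)
Lemma excess_mul_le (lam x y : R) : 0 <= lam ->
  Num.max 0 (`|lam * (x * y)| - 1) <=
  Num.max 0 (lam * x ^+ 2 - 1) + Num.max 0 (lam * y ^+ 2 - 1).
Proof.
move=> l0.
have hx : 0 <= Num.max 0 (lam * x ^+ 2 - 1) by rewrite le_max lexx.
have hy : 0 <= Num.max 0 (lam * y ^+ 2 - 1) by rewrite le_max lexx.
have hx' : lam * x ^+ 2 - 1 <= Num.max 0 (lam * x ^+ 2 - 1) by rewrite le_max lexx orbT.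
have hy' : lam * y ^+ 2 - 1 <= Num.max 0 (lam * y ^+ 2 - 1) by rewrite le_max lexx orbT.
rewrite ge_max addr_ge0//= normrM ger0_norm// normrM.
have : `|x| * `|y| <= x ^+ 2 \/ `|x| * `|y| <= y ^+ 2.
  rewrite -(real_normK (num_real x)) -(real_normK (num_real y)).
  have := normr_ge0 x; have := normr_ge0 y.
  by have [xy|xy] := leP `|x| `|y|; [right|left]; nra.
by case=> /(ler_wpM2l l0); lra.
Qed.

End truncation.

(** * Uniform bounds over the unit ball *)

Lemma sum_sqr_le_sqr_sum {R : realType} (I : finType) (a : I -> R) :
  (forall i, 0 <= a i) -> \sum_i a i ^+ 2 <= (\sum_i a i) ^+ 2.
Proof.
move=> a0; rewrite expr2 mulr_suml; apply: ler_sum => i _.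
by rewrite expr2 ler_wpM2l// (bigD1 i)//= lerDl sumr_ge0.
Qed.

Lemma dotv_mulmxC {R : realType} (d : nat) (A : 'M[R]_d) (u v : 'cV[R]_d) :
  dotv u (A *m v) = dotv v (A^T *m u).
Proof. by rewrite dotvC /dotv trmx_mul mulmxA. Qed.

Section sample_bounds.
Context {R : realType} {n d K : nat}.
Hypothesis K0 : (0 < K)%N.
Variables (S : 'M[R]_d) (eta sb lam gam tau : R).
Local Notation TH := {ffun 'I_d * 'I_K -> bool}.
Implicit Types (th nu : TH) (z u v : 'cV[R]_d).

Definition quad th : R := dotv (rvec th) (S *m rvec th).

(** The mean energy is at most [5 * sb], so by Markov's inequality failure has probability at most
    [pzc ^+ 2], as [tE_trunc_ge] requires; 9 is a convenient square above 5. *)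
Definition good th : bool := quad th <= 9 * sb / pzc ^+ 2.

Definition clipped_product (p : TH * TH) z : R :=
  clip1 (lam * (dotv (rvec p.1) z * dotv (rvec p.2) z)).

(** Bounds the log-Laplace transform of [clipped_product]: [lam] times the mean plus [2 * lam ^+ 2]
    times the second moment, regularized by [sb]. *)
Definition clipped_rate (p : TH * TH) : R :=
  lam * dotv (rvec p.1) (S *m rvec p.2) +
  512 * lam ^+ 2 * eta ^+ 4 * ((quad p.1 + sb) * (quad p.2 + sb)).

Definition linear_excess th z : R :=
  if good th then gam * Num.max 0 (`|dotv (rvec th) z| - tau) else 0.

Definition linear_rate : R := 2 * expR (- (gam * tau)).

Definition noise_part z : R := small_part lam (sig2 K z).

Definition noise_rate : R := (48 * 1024) * lam ^+ 2 * eta ^+ 4 * sb ^+ 2.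

Hypothesis S_psd : forall u, 0 <= dotv u (S *m u).
Hypothesis sb0 : 0 < sb.
Hypothesis S_op : forall u, norm2 u <= 1 -> dotv u (S *m u) <= sb.
Hypothesis S_tr : \tr S <= K%:R * sb.

Lemma S_diag_ge0 j : 0 <= S j j.
Proof.
have := S_psd (delta_mx j 0); rewrite -colE dotvE (bigD1 j)//= !mxE !eqxx mul1r.
by rewrite big1 ?addr0// => i /negbTE ij; rewrite mxE ij mul0r.
Qed.

Lemma tE_quad_le u : norm2 u <= 1 -> tE (bias u) quad <= 5 * sb.
Proof.
move=> u1; apply: le_trans (tE_quad_rvec K0 u1 S_diag_ge0) _.
have -> : 5 * sb = sb + 4 * sb by ring.
apply: lerD; first exact: S_op.
have Kp : 0 < K%:R :> R by rewrite ltr0n.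
have -> : 4 * sb = 4 / K%:R * (K%:R * sb) by field; rewrite gt_eqF.
by apply: ler_wpM2l => //; rewrite divr_ge0 ?(ltW Kp).
Qed.

Lemma tE_bad_le u : norm2 u <= 1 ->
  tE (bias u) (fun th => (~~ good th)%:R) <= pzc ^+ 2.
Proof.
move=> u1; have c0 := @pzc_gt0 R; have sbn0 : sb != 0 by rewrite gt_eqF.
have k0 : 0 <= pzc ^+ 2 / (9 * sb) by rewrite divr_ge0 ?sqr_ge0 ?mulr_ge0// ltW.
apply: (@le_trans _ _ (tE (@bias _ _ K u) (fun th => pzc ^+ 2 / (9 * sb) * quad th))).
  apply: ler_tE => [p|th]; first exact: bias_le1.
  rewrite /good; case: (leP (quad th)) => /= h; first by rewrite mulr0n; apply: mulr_ge0 => //; exact: S_psd.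
  have := ler_wpM2l k0 (ltW h).
  by rewrite (_ : _ * (_ / _) = 1)//; field; rewrite sbn0 gt_eqF.
rewrite tEZ; apply: le_trans (ler_wpM2l k0 (tE_quad_le u1)) _.
have -> : pzc ^+ 2 / (9 * sb) * (5 * sb) = 5 / 9 * pzc ^+ 2 by field.
by have := sqr_ge0 (@pzc R); lra.
Qed.

Variables (z : 'I_n -> 'cV[R]_d) (t : R).

(** From here on the sample [z] is fixed. Randomness survives only in the two inequalities below,
    which hold off the exceptional events of [pac_bayes]. *)
Hypothesis event_linear :
  \sum_th tilt (fun=> 0) th *
    expR (\sum_i linear_excess th (z i) - n%:R * linear_rate) <= expR t.

Hypothesis event_product :
  \sum_p (tilt (fun=> 0) p.1 * tilt (fun=> 0) p.2) *
    expR (\sum_i clipped_product p (z i) - n%:R * clipped_rate p) <= expR t.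

Lemma sum_linear_excess_le u : norm2 u <= 1 ->
  \sum_i tE (bias u) (linear_excess ^~ (z i)) <= t + K%:R / 4 + n%:R * linear_rate.
Proof.
move=> u1; have [l lE lle] := tE_loglik (fun p : 'I_d * 'I_K => bias_lt1 p u1).
have := donsker_varadhan _ _ lE event_linear.
have h1 th : 0 <= tilt (bias u) th by apply: tilt_ge0 => p; exact: bias_le1.
have h2 : \sum_th tilt (@bias _ _ K u) th = 1.
  rewrite -[RHS](tE_cst (@bias _ _ K u) 1).
  by apply: eq_bigr => th _; rewrite mulr1.
move=> /(_ h1 h2); rewrite -/(tE _ _) -/(tE _ _) tED tE_cst tE_sum.
by have := @sum_bias_sqr R d K u u1; lra.
Qed.

Let tE_pair u v (F : TH -> TH -> R) :
  \sum_p (tilt (bias u) p.1 * tilt (bias v) p.2) * F p.1 p.2 =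
  tE (bias u) (fun th => tE (bias v) (F th)).
Proof.
rewrite -(pair_bigA _ (fun th nu => tilt (bias u) th * tilt (bias v) nu * F th nu)) /=.
apply: eq_bigr => th _; rewrite /tE mulr_sumr; apply: eq_bigr => nu _.
by rewrite mulrA.
Qed.

(** The posterior is a product, so the two entropies add up to [K / 2] and the rate averages factor
    by factor: [512 * 6 * 6] is [18 * 1024]. *)
Lemma sum_clipped_product_le u v : norm2 u <= 1 -> norm2 v <= 1 ->
  \sum_i tE (bias u) (fun th => tE (bias v) (fun nu => clipped_product (th, nu) (z i))) <=
  t + K%:R / 2 + n%:R * (lam * dotv u (S *m v) + (18 * 1024) * lam ^+ 2 * eta ^+ 4 * sb ^+ 2).
Proof.
move=> u1 v1.
have [l lE lle] := tE_loglik (fun p : 'I_d * 'I_K => bias_lt1 p u1).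
have [l' lE' lle'] := tE_loglik (fun p : 'I_d * 'I_K => bias_lt1 p v1).
pose rho (p : TH * TH) := tilt (bias u) p.1 * tilt (bias v) p.2.
have h1 p : 0 <= rho p.
  by apply: mulr_ge0; apply: tilt_ge0 => q; exact: bias_le1.
have h2 : \sum_p rho p = 1.
  transitivity (\sum_p rho p * (fun _ _ => 1) p.1 p.2).
    by apply: eq_bigr => p _; rewrite mulr1.
  by rewrite (tE_pair u v (fun _ _ => 1)) !tE_cst.
have rhoE p : rho p = (tilt (fun=> 0) p.1 * tilt (fun=> 0) p.2) * expR (l p.1 + l' p.2).
  by rewrite /rho lE lE' expRD; ring.
have := donsker_varadhan h1 h2 rhoE event_product.
rewrite (tE_pair u v (fun th nu => l th + l' nu)).
rewrite [X in X <= _](_ : _ = tE (bias u) (fun th => tE (bias v) (fun nu =>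
    \sum_i clipped_product (th, nu) (z i) + - n%:R * clipped_rate (th, nu)))); last first.
  rewrite -tE_pair; apply: eq_bigr => -[th nu] _ /=; rewrite /rho/=.
  by congr (_ * _); ring.
have -> : tE (@bias _ _ K u) (fun th => tE (@bias _ _ K v) (fun nu => l th + l' nu)) =
    tE (bias u) l + tE (bias v) l'.
  rewrite (tE_eq _ (G := fun th => l th + tE (@bias _ _ K v) l')); first by rewrite tED tE_cst.
  by move=> th; rewrite tED tE_cst.
have -> : tE (@bias _ _ K u) (fun th => tE (@bias _ _ K v) (fun nu =>
    \sum_i clipped_product (th, nu) (z i) + - n%:R * clipped_rate (th, nu))) =
  \sum_i tE (bias u) (fun th => tE (bias v) (fun nu => clipped_product (th, nu) (z i))) +
  - n%:R * tE (bias u) (fun th => tE (bias v) (fun nu => clipped_rate (th, nu))).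
  rewrite -tE_sum -tEZ -tED; apply: tE_eq => th.
  by rewrite tED tE_sum tEZ.
have rate : tE (@bias _ _ K u) (fun th => tE (@bias _ _ K v) (fun nu => clipped_rate (th, nu))) <=
    lam * dotv u (S *m v) + (18 * 1024) * lam ^+ 2 * eta ^+ 4 * sb ^+ 2.
  have k0 : 0 <= 512 * lam ^+ 2 * eta ^+ 4.
    apply: mulr_ge0; last exact: exprn_even_ge0.
    by apply: mulr_ge0; [exact: ler0n|exact: sqr_ge0].
  have Q6 w : norm2 w <= 1 -> 0 <= tE (@bias _ _ K w) (fun th => quad th + sb) <= 6 * sb.
    move=> w1; rewrite tED tE_cst; have := tE_quad_le w1 => qle.
    have q0 : 0 <= tE (@bias _ _ K w) quad.
      rewrite -(tE_cst (@bias _ _ K w) 0); apply: ler_tE => [p|th]; first exact: bias_le1.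
      exact: S_psd.
    by apply/andP; split; lra.
  rewrite (tE_eq _ (G := fun th => lam * dotv (rvec th) (S *m v) +
     512 * lam ^+ 2 * eta ^+ 4 * tE (@bias _ _ K v) (fun nu => quad nu + sb) * (quad th + sb))).
    rewrite tED !tEZ tE_dotv_rvec//; apply: lerD => //.
    have /andP[u0 u6] := Q6 _ u1; have /andP[v0 v6] := Q6 _ v1.
    rewrite -mulrA.
    apply: le_trans (ler_wpM2l k0 (ler_pM v0 u0 v6 u6)) _.
    by rewrite le_eqVlt; apply/orP; left; apply/eqP; ring.
  move=> th; rewrite /clipped_rate /= tED [X in X + _]tEZ.
  congr (_ + _).
    congr (_ * _); rewrite dotv_mulmxC -(tE_dotv_rvec K0 v); apply: tE_eq => nu.
    exact: dotv_mulmxC.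
  rewrite -tEZ -[RHS]mulrC -tEZ; apply: tE_eq => nu; ring.
have := ler_wpM2l (ler0n R n) rate.
have := @sum_bias_sqr R d K u u1; have := @sum_bias_sqr R d K v v1; lra.
Qed.

End sample_bounds.

(** * The deviation of a fixed sample *)

Section deterministic_bound.
Context {R : realType} {n d K : nat}.
Hypothesis K0 : (0 < K)%N.
Variables (S : 'M[R]_d) (eta sb g q x t : R) (z : 'I_n -> 'cV[R]_d).
Hypothesis S_psd : forall u : 'cV[R]_d, 0 <= dotv u (S *m u).
Hypothesis sb0 : 0 < sb.
Hypothesis S_op : forall u : 'cV[R]_d, norm2 u <= 1 -> dotv u (S *m u) <= sb.
Hypothesis S_tr : \tr S <= K%:R * sb.
Hypothesis g0 : 0 < g.
Hypothesis q0 : 0 < q.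
Hypothesis gE : g ^+ 2 = eta ^+ 2 * sb.
Hypothesis Kx : K%:R <= x.
Hypothesis tx : t <= x.
Hypothesis nx : n%:R <= x * q ^+ 4.

(* [g = eta * sqrt sb] bounds the scale of [dotv (rvec th) Z] for [good] values
   of [th], hence [slope] is small enough for [expR (slope * _)] of it to be
   integrable.  Products are clipped at [1 / scale = (g q)^2], and [threshold]
   is a small multiple of the corresponding level [g q] for linear forms. *)
Definition scale : R := ((g * q) ^+ 2)^-1.
Definition threshold : R := pzc * (g * q) / 4.
Definition slope : R := pzc / (24 * g).

Hypothesis event_linear :
  \sum_(th : {ffun 'I_d * 'I_K -> bool}) tilt (fun=> 0) th *
    expR (\sum_i linear_excess S sb slope threshold th (z i) -
          n%:R * linear_rate slope threshold) <= expR t.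

Hypothesis event_product :
  \sum_(p : {ffun 'I_d * 'I_K -> bool} * {ffun 'I_d * 'I_K -> bool})
    (tilt (fun=> 0) p.1 * tilt (fun=> 0) p.2) *
    expR (\sum_i clipped_product scale p (z i) -
          n%:R * clipped_rate S eta sb scale p) <= expR t.

Hypothesis event_noise :
  \sum_i noise_part (K := K) scale (z i) - n%:R * noise_rate eta sb scale <= t.

Definition cst_exp : R := 24 * 96 ^+ 4 / pzc ^+ 8.
Definition cst_big : R := (96 * (1 + cst_exp) / pzc ^+ 2) ^+ 2.
Definition cst_small : R := (18 * 1024 + 2) + 4 * kurt * (48 * 1024 + 1).

Let c0 : 0 < @pzc R := pzc_gt0.
Let gn : g != 0. Proof. by rewrite gt_eqF. Qed.
Let qn : q != 0. Proof. by rewrite gt_eqF. Qed.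
Let cn : @pzc R != 0. Proof. by rewrite gt_eqF. Qed.

Let scale0 : 0 < scale.
Proof. by rewrite /scale invr_gt0 exprn_gt0// mulr_gt0. Qed.

Let x0 : 0 <= x. Proof. exact: le_trans Kx. Qed.

(** The product in parentheses is exactly [q ^- 4]; hypothesis [nx] is made for this bound and the
    next one. *)
Let scale_rate : n%:R * (scale ^+ 2 * eta ^+ 4 * sb ^+ 2) <= x.
Proof.
have -> : scale ^+ 2 * eta ^+ 4 * sb ^+ 2 = (q ^+ 4)^-1.
  have -> : scale ^+ 2 * eta ^+ 4 * sb ^+ 2 = scale ^+ 2 * (eta ^+ 2 * sb) ^+ 2 by ring.
  by rewrite -gE /scale; field; rewrite gn qn.
by rewrite ler_pdivrMr ?exprn_gt0.
Qed.

Let linear_rate_le : n%:R * linear_rate slope threshold <= 2 * cst_exp * x.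
Proof.
rewrite /linear_rate.
pose y := slope * threshold.
have yE : y = pzc ^+ 2 * q / 96 by rewrite /y /slope /threshold; field.
have y0 : 0 < y by rewrite yE divr_gt0// mulr_gt0// exprn_gt0.
(* Fourth-order decay is all that is kept of the exponential, to match [q ^- 4]. *)
have ey : expR (- y) <= 24 / y ^+ 4.
  rewrite expRN -[24 / _]invf_div lef_pV2 ?posrE ?divr_gt0 ?exprn_gt0 ?expR_gt0//.
  by have := expR_ge1Dxn 3 (ltW y0); rewrite (_ : (4`!%:R : R) = 24)//; lra.
rewrite -/y.
apply: (@le_trans _ _ (x * q ^+ 4 * (2 * (24 / y ^+ 4)))).
  by apply: ler_pM => //; rewrite ?mulr_ge0 ?expR_ge0// ler_wpM2l.
rewrite le_eqVlt; apply/orP; left; apply/eqP.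
by rewrite yE /cst_exp; field; rewrite cn qn.
Qed.

(** A nonzero term means that [A i] exceeds [g * q / 2]. Then [threshold] is at most half of
    [pzc * A i], and [A i] is bounded by a multiple of the linear excess [E i]. The sum of the [E i]
    is of order [x], and the sum of squares is at most the square of the sum. *)
Let big_part_le u : norm2 u <= 1 ->
  \sum_i big_part scale (dotv u (z i) ^+ 2 + sig2 K (z i)) <= cst_big * (x ^+ 2 / q ^+ 2).
Proof.
move=> u1.
pose A i := Num.sqrt (dotv u (z i) ^+ 2 + sig2 K (z i)).
have A0 i : 0 <= A i by exact: sqrtr_ge0.
have AE i : A i ^+ 2 = dotv u (z i) ^+ 2 + sig2 K (z i).
  by rewrite sqr_sqrtr// addr_ge0 ?sqr_ge0 ?sig2_ge0.
pose E i := tE (@bias _ _ K u) (linear_excess S sb slope threshold ^~ (z i)).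
have slope0 : 0 < slope by rewrite divr_gt0// mulr_gt0.
have th0 : 0 <= threshold by rewrite /threshold divr_ge0// ltW// !mulr_gt0.
have E0 i : 0 <= E i.
  rewrite -(tE_cst (@bias _ _ K u) 0); apply: ler_tE => [p|th]; first exact: bias_le1.
  rewrite /linear_excess; case: ifP => // _; apply: mulr_ge0; first exact: ltW.
  by rewrite le_max lexx.
have EA i : slope * (pzc * A i - threshold) <= E i.
  have := tE_trunc_ge K0 u1 (A0 i) (AE i) th0 (tE_bad_le K0 S_psd sb0 S_op S_tr u1).
  move=> /(ler_wpM2l (ltW slope0)) /le_trans; apply.
  rewrite -tEZ le_eqVlt; apply/orP; left; apply/eqP; apply: tE_eq => th.
  by rewrite /linear_excess; case: ifP => // _; rewrite mulr0.
have EA' i : big_part scale (A i ^+ 2) <= scale * (2 / (pzc * slope) * E i) ^+ 2.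
  rewrite /big_part; case: ltP => h; last first.
    by apply: mulr_ge0; [exact: ltW|exact: sqr_ge0].
  rewrite ler_pM2l//.
  have Agq : g * q / 2 <= A i.
    have gq2 : 0 <= g * q / 2 by rewrite divr_ge0// ltW// mulr_gt0.
    rewrite -(@ler_pXn2r _ 2) ?nnegrE//.
    move: h; rewrite /scale [X in _ < X]mulrC ltr_pdivlMr ?exprn_gt0 ?mulr_gt0// => h.
    have -> : (g * q / 2) ^+ 2 = 1 / 4 * (g * q) ^+ 2 by field.
    exact: ltW.
  have half : slope * (pzc * A i / 2) <= E i.
    apply: le_trans (EA i); rewrite ler_pM2l// /threshold.
    have := ler_wpM2l (ltW c0) Agq; lra.
  have AleE : A i <= 2 / (pzc * slope) * E i.
    have k0 : 0 <= 2 / (pzc * slope) by rewrite divr_ge0// mulr_ge0// ltW.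
    have := ler_wpM2l k0 half; congr (_ <= _).
    by field; rewrite cn gt_eqF.
  by rewrite lerXn2r ?nnegrE// (le_trans (A0 i)).
apply: (@le_trans _ _ (\sum_i scale * (2 / (pzc * slope) * E i) ^+ 2)).
  by apply: ler_sum => i _; rewrite -AE; exact: EA'.
rewrite -mulr_sumr.
have k0 : 0 <= 2 / (pzc * slope) by rewrite divr_ge0// mulr_ge0// ltW.
apply: le_trans (ler_wpM2l (ltW scale0) (sum_sqr_le_sqr_sum (fun i => mulr_ge0 k0 (E0 i)))) _.
rewrite -mulr_sumr.
have sumE : \sum_i E i <= 2 * (1 + cst_exp) * x.
  have sl := sum_linear_excess_le event_linear u1.
  apply: le_trans sl _.
  have := linear_rate_le; have := x0; have := Kx; have := tx; have := ler0n R K; nra.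
have sumE0 : 0 <= \sum_i E i by apply: sumr_ge0.
have : (2 / (pzc * slope) * \sum_i E i) ^+ 2 <=
    (2 / (pzc * slope) * (2 * (1 + cst_exp) * x)) ^+ 2.
  rewrite lerXn2r ?nnegrE ?ler_wpM2l// mulr_ge0//.
  exact: le_trans sumE.
move=> /(ler_wpM2l (ltW scale0)) /le_trans; apply.
rewrite le_eqVlt; apply/orP; left; apply/eqP.
by rewrite /scale /slope /cst_big; field; rewrite cn gn qn.
Qed.

Let excess_le u : norm2 u <= 1 ->
  \sum_i tE (@bias _ _ K u) (fun th => Num.max 0 (scale * dotv (rvec th) (z i) ^+ 2 - 1)) <=
  cst_big * (x ^+ 2 / q ^+ 2) + 2 * kurt * ((48 * 1024 + 1) * x).
Proof.
move=> u1.
apply: (@le_trans _ _ (\sum_i (big_part scale (dotv u (z i) ^+ 2 + sig2 K (z i)) +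
    2 * kurt * noise_part (K := K) scale (z i)))).
  by apply: ler_sum => i _; apply: tE_excess_le => //; exact: ltW.
rewrite big_split /= -mulr_sumr; apply: lerD; first exact: big_part_le.
have k1 := @kurt_ge1 R; apply: ler_wpM2l; first by lra.
have : n%:R * noise_rate eta sb scale <= (48 * 1024) * x.
  rewrite /noise_rate (_ : n%:R * _ = (48 * 1024) * (n%:R * (scale ^+ 2 * eta ^+ 4 * sb ^+ 2))); last by ring.
  by apply: ler_wpM2l scale_rate; apply: mulr_ge0; exact: ler0n.
by have := event_noise; have := tx; lra.
Qed.

(** The product of the two linear forms is the exact mean of its randomized version, which is at
    most its clipped part plus one excess term for each of [u] and [v]. *)
Lemma deterministic_bound u v : norm2 u <= 1 -> norm2 v <= 1 ->
  \sum_i dotv u (z i) * dotv v (z i) - n%:R * dotv u (S *m v) <=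
  g ^+ 2 * (cst_small * q ^+ 2 * x + 2 * cst_big * x ^+ 2).
Proof.
move=> u1 v1.
have u1' : forall p, `|@bias _ _ K u p| <= 1 by move=> p; exact: bias_le1.
have v1' : forall p, `|@bias _ _ K v p| <= 1 by move=> p; exact: bias_le1.
have hA := sum_clipped_product_le K0 S_psd S_op S_tr event_product u1 v1.
have hu := excess_le u1; have hv := excess_le v1.
have step i : scale * (dotv u (z i) * dotv v (z i)) <=
  tE (@bias _ _ K u) (fun th => tE (@bias _ _ K v) (fun nu => clipped_product scale (th, nu) (z i))) +
  (tE (@bias _ _ K u) (fun th => Num.max 0 (scale * dotv (rvec th) (z i) ^+ 2 - 1)) +
   tE (@bias _ _ K v) (fun th => Num.max 0 (scale * dotv (rvec th) (z i) ^+ 2 - 1))).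
  have -> : scale * (dotv u (z i) * dotv v (z i)) = tE (@bias _ _ K u) (fun th =>
      tE (@bias _ _ K v) (fun nu => scale * (dotv (rvec th) (z i) * dotv (rvec nu) (z i)))).
    rewrite (tE_eq _ (G := fun th => scale * dotv v (z i) * dotv (rvec th) (z i))).
      by rewrite tEZ tE_dotv_rvec//; ring.
    by move=> th; rewrite !tEZ tE_dotv_rvec//; ring.
  (* An average over one randomization is viewed as constant in the other, so that the comparison
     becomes pointwise in both. *)
  rewrite -[X in _ + (_ + X)](tE_cst (@bias _ _ K u)) -!tED.
  apply: ler_tE => // th.
  rewrite -[X in _ + (X + _)](tE_cst (@bias _ _ K v)) -!tED.
  apply: ler_tE => // nu.
  apply: le_trans (le_clip1 _) _; apply: lerD => //.
  by apply: excess_mul_le; exact: ltW.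
have : \sum_i scale * (dotv u (z i) * dotv v (z i)) <= _ := ler_sum _ (fun i _ => step i).
rewrite !big_split /= -mulr_sumr => total.
have rate : n%:R * ((18 * 1024) * scale ^+ 2 * eta ^+ 4 * sb ^+ 2) <= (18 * 1024) * x.
  rewrite (_ : n%:R * _ = (18 * 1024) * (n%:R * (scale ^+ 2 * eta ^+ 4 * sb ^+ 2))); last by ring.
  by apply: ler_wpM2l scale_rate; apply: mulr_ge0; exact: ler0n.
have main : scale * (\sum_i dotv u (z i) * dotv v (z i) - n%:R * dotv u (S *m v)) <=
    cst_small * x + 2 * cst_big * (x ^+ 2 / q ^+ 2).
  have -> : cst_small * x = (18 * 1024) * x + 2 * x + 4 * (kurt * ((48 * 1024 + 1) * x)).
    by rewrite /cst_small; ring.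
  have -> : 2 * cst_big * (x ^+ 2 / q ^+ 2) = 2 * (cst_big * (x ^+ 2 / q ^+ 2)) by rewrite -[LHS]mulrA.
  rewrite mulrBr (mulrCA scale n%:R).
  rewrite mulrDr in hA; rewrite -mulrA in hu; rewrite -mulrA in hv.
  have x0' := x0; have Kx' := Kx; have tx' := tx; have Kpos := ler0n R K.
  move: hA hu hv total rate; move: (kurt * _) (cst_big * _) => k B.
  move: ((18 * 1024) * x) (n%:R * (scale * _)) (n%:R * (_ * sb ^+ 2)) => X D r.
  lra.
have gq0 : 0 <= (g * q) ^+ 2 by exact: sqr_ge0.
have cancel y : (g * q) ^+ 2 * (scale * y) = y.
  by rewrite /scale; field; rewrite gn qn.
have := ler_wpM2l gq0 main; rewrite cancel => /le_trans; apply.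
by rewrite le_eqVlt; apply/orP; left; apply/eqP; field.
Qed.

End deterministic_bound.

(** * Exponential moments of the truncated statistics *)

Lemma ge0_le_integral_real {R : realType} d (T : measurableType d)
    (m : {measure set T -> \bar R}) (f g : T -> R) :
    measurable_fun [set: T] f -> measurable_fun [set: T] g ->
    (forall x, 0 <= f x) -> (forall x, f x <= g x) ->
  (\int[m]_x (f x)%:E <= \int[m]_x (g x)%:E)%E.
Proof.
move=> mf mg f0 fg; apply: ge0_le_integral => //.
- by move=> x _; rewrite lee_fin.
- exact/measurable_EFinP.
- exact/measurable_EFinP.
- by move=> x _; rewrite lee_fin.
Qed.

Lemma integral_1D_le {R : realType} d (T : measurableType d)
    (P : probability T R) (k B : R) (f : T -> R) :
    0 <= k -> measurable_fun [set: T] f -> (forall x, 0 <= f x) ->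
    (\int[P]_x (f x)%:E <= B%:E)%E ->
  (\int[P]_x (1 + k * f x)%:E <= (1 + k * B)%:E)%E.
Proof.
move=> k0 mf f0 fB; under eq_integral do rewrite EFinD.
rewrite ge0_integralD//; last 2 first.
- by move=> x _; rewrite lee_fin mulr_ge0.
- by apply/measurable_EFinP; exact: measurable_funM.
rewrite ge0_integralZl_real// integral_cst// mul1e EFinD EFinM; apply: leeD.
  exact: probability_le1.
by apply: lee_wpmul2l => //; rewrite lee_fin.
Qed.

Section covariance_deviation.
Context {R : realType} {d : nat} {disp0 : measure_display} {T0 : measurableType disp0}
  (P0 : probability T0 R) (Z : {RV P0 >-> borel_cV R d}).
Variables (Sigma : 'M[R]_d) (eta : R).
Hypothesis cov : has_mean P0 (fun w => (Z w : 'cV[R]_d) *m (Z w : 'cV[R]_d)^T) Sigma.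
Hypothesis eta1 : 1 <= eta.
Hypothesis moment : forall (u : 'cV[R]_d) (p : R), 1 <= p ->
  ('N[P0]_p%:E[(fun w => (dotv u (Z w))%:E)] <= (eta * p * normS Sigma u)%:E)%E.

Let mZ : measurable_fun [set: T0] Z. Proof. exact: measurable_funPT. Qed.
Let eta0 : 0 <= eta. Proof. exact: le_trans ler01 eta1. Qed.

Lemma integral_expR_clip1_le (Y : T0 -> R) (lam m V : R) :
    measurable_fun [set: T0] Y ->
    (\int[P0]_w (Y w)%:E = m%:E)%E ->
    (\int[P0]_w (Y w ^+ 2)%:E <= V%:E)%E ->
  (\int[P0]_w (expR (clip1 (lam * Y w)))%:E <= (expR (lam * m + 2 * lam ^+ 2 * V))%:E)%E.
Proof.
move=> mY Ym YV.
have mY2 : measurable_fun [set: T0] (fun w => Y w ^+ 2) by exact: measurable_funX.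
have iY2 : P0.-integrable [set: T0] (fun w => (Y w ^+ 2)%:E).
  apply/integrableP; split; first exact/measurable_EFinP.
  under eq_integral do rewrite abse_EFin ger0_norm ?sqr_ge0//.
  by apply: le_lt_trans YV _; rewrite ltry.
have i1 : P0.-integrable [set: T0] (fun=> (1 : R)%:E).
  exact: finite_measure_integrable_cst.
have iY : P0.-integrable [set: T0] (fun w => (Y w)%:E).
  apply: (le_integrable measurableT _ _ (integrableD measurableT i1 iY2)).
    exact/measurable_EFinP.
  move=> w _ /=; rewrite lee_fin [leRHS]ger0_norm ?addr_ge0 ?sqr_ge0//.
  by rewrite -(real_normK (num_real (Y w))); have := sqr_ge0 (`|Y w| - 1); nra.
have mc : measurable_fun [set: T0] (fun w => expR (clip1 (lam * Y w))).
  apply: measurableT_comp => //; apply: measurable_maxr => //.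
  by apply: measurable_minr => //; exact: measurable_funM.
apply: (@le_trans _ _ (\int[P0]_w (1 + (lam * Y w + 2 * lam ^+ 2 * Y w ^+ 2))%:E)%E).
  apply: ge0_le_integral_real => //.
  - apply: measurable_funD => //; apply: measurable_funD; exact: measurable_funM.
  move=> w; have := expR_clip1_le (lam * Y w).
  by rewrite exprMn; lra.
under eq_integral do rewrite EFinD EFinD EFinM (EFinM (2 * lam ^+ 2)).
rewrite integralD//; last by apply: integrableD => //; exact: integrableZl.
rewrite integralD//; [|exact: integrableZl|exact: integrableZl].
rewrite !integralZl// Ym integral_cst// mul1e.
have k0 : (0 <= (2 * lam ^+ 2)%:E)%E by rewrite lee_fin mulr_ge0 ?sqr_ge0.
apply: (@le_trans _ _ ((1 : R)%:E + (lam%:E * m%:E + (2 * lam ^+ 2)%:E * V%:E))%E).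
  apply: leeD; first exact: probability_le1.
  by apply: leeD => //; exact: lee_wpmul2l.
by rewrite -!EFinM -!EFinD lee_fin expR_ge1Dx.
Qed.

Section rates.
Variables (K : nat) (g q sb : R).
Hypothesis d0 : (0 < d)%N.
Hypothesis K0 : (0 < K)%N.
Hypothesis g0 : 0 < g.
Hypothesis q0 : 0 < q.
Hypothesis sb0 : 0 < sb.
Hypothesis gE : g ^+ 2 = eta ^+ 2 * sb.
Hypothesis S_tr : \tr Sigma <= K%:R * sb.
Local Notation TH := {ffun 'I_d * 'I_K -> bool}.
Local Notation lam := (scale g q).
Local Notation tau := (threshold g q).
Local Notation gam := (slope g).

(** For [good] values [eta * normS] is at most [3 * g / pzc], and [slope] times this is 1/8, the
    limit allowed by [integral_expR_dotv_le2]. The threshold then gains the factor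
    [expR (- (gam * tau))]. For other values the exponent is 0. *)
Lemma linear_excess_mgf (th : TH) :
  (\int[P0]_w (expR (linear_excess Sigma sb gam tau th (Z w)))%:E <=
   (expR (linear_rate gam tau))%:E)%E.
Proof.
have c0 := @pzc_gt0 R.
have r0 : 0 <= linear_rate gam tau.
  by apply: mulr_ge0 => //; exact: expR_ge0.
rewrite /linear_excess; case: (boolP (good Sigma sb th)) => gth; last first.
  under eq_integral do rewrite expR0.
  rewrite integral_cst// mul1e; apply: le_trans (probability_le1 _ _) _ => //.
  by rewrite lee_fin -expR0 ler_expR.
have gam0 : 0 < gam by rewrite /slope divr_gt0// mulr_gt0.
pose X w := dotv (rvec th) (Z w).
have mX : measurable_fun [set: T0] X := measurable_dotvZ _ _.
have mE : measurable_fun [set: T0] (fun w => expR (gam * `|X w|)).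
  apply: measurableT_comp => //; apply: measurable_funM => //.
  exact: measurableT_comp.
have E2 : (\int[P0]_w (expR (gam * `|X w|))%:E <= 2%:E)%E.
  apply: (integral_expR_dotv_le2 eta1 moment (ltW gam0)).
  have nS : normS Sigma (rvec th) ^+ 2 = quad Sigma th := sqr_normS cov moment _.
  have n0 := normS_ge0 Sigma (rvec th).
  have bound : eta * normS Sigma (rvec th) <= 3 * g / pzc.
    have h1 : 0 <= eta * normS Sigma (rvec th) by exact: mulr_ge0.
    have h2 : 0 <= 3 * g / pzc by apply: divr_ge0; [apply: mulr_ge0 => //|]; exact: ltW.
    rewrite -(@ler_pXn2r _ 2) ?nnegrE//.
    rewrite exprMn nS; move: gth; rewrite /good => /(ler_wpM2l (sqr_ge0 eta)) /le_trans; apply.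
    rewrite le_eqVlt; apply/orP; left; apply/eqP.
    rewrite -[RHS](_ : 9 * g ^+ 2 / pzc ^+ 2 = _); last by field; rewrite gt_eqF.
    by rewrite gE; ring.
  have := ler_wpM2l (ltW gam0) bound.
  have -> : gam * (3 * g / pzc) = 1 / 8 by rewrite /slope; field; rewrite !gt_eqF.
  lra.
apply: (@le_trans _ _ (\int[P0]_w (1 + expR (- (gam * tau)) * expR (gam * `|X w|))%:E)%E).
  apply: ge0_le_integral_real => //.
  - apply: measurableT_comp => //; apply: measurable_funM => //.
    apply: measurable_maxr => //; apply: measurable_funB => //.
    exact: measurableT_comp.
  - apply: measurable_funD => //; exact: measurable_funM.
  move=> w; rewrite -/(X w) -expRD.
  have [h|h] := leP (`|X w| - tau) 0.
    by rewrite mulr0 expR0 lerDl expR_ge0.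
  by rewrite -[leLHS]add0r; apply: lerD => //; rewrite ler_expR; lra.
apply: le_trans (integral_1D_le (expR_ge0 _) mE (fun=> expR_ge0 _) E2) _.
rewrite lee_fin; apply: le_trans (expR_ge1Dx _).
by rewrite /linear_rate mulrC.
Qed.

Lemma clipped_product_mgf (p : TH * TH) :
  (\int[P0]_w (expR (clipped_product lam p (Z w)))%:E <=
   (expR (clipped_rate Sigma eta sb lam p))%:E)%E.
Proof.
have mXY : measurable_fun [set: T0] (fun w => dotv (rvec p.1) (Z w) * dotv (rvec p.2) (Z w)).
  by apply: measurable_funM; exact: measurable_dotvZ.
apply: le_trans (integral_expR_clip1_le lam mXY
  (integral_dotv_mul cov moment (rvec p.1) (rvec p.2))
  (integral_dotv_sqr_mul_le cov moment (rvec p.1) (rvec p.2) sb0)) _.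
rewrite lee_fin ler_expR /clipped_rate /quad; apply: lerD => //.
by rewrite le_eqVlt; apply/orP; left; apply/eqP; ring.
Qed.

Lemma noise_part_mgf :
  (\int[P0]_w (expR (noise_part (K := K) lam (Z w)))%:E <=
   (expR (noise_rate eta sb lam))%:E)%E.
Proof.
have Kp : 0 < K%:R :> R by rewrite ltr0n.
pose k := 3 * lam ^+ 2 * (4 / K%:R) ^+ 2.
have k0 : 0 <= k by rewrite /k; apply: mulr_ge0; [apply: mulr_ge0; [exact: ler0n|]|]; exact: sqr_ge0.
have mN : measurable_fun [set: T0] (fun w => dotv (Z w : 'cV[R]_d) (Z w) ^+ 2).
  apply: measurable_funX; exact: (measurableT_comp measurable_dotvv mZ).
apply: (@le_trans _ _ (\int[P0]_w (1 + k * dotv (Z w : 'cV[R]_d) (Z w) ^+ 2)%:E)%E).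
  apply: ge0_le_integral_real => //.
  - apply: measurableT_comp => //; apply: measurable_minr => //.
    rewrite /sig2; under eq_fun do rewrite exprMn.
    by apply: measurable_funM => //; exact: measurable_funM.
  - apply: measurable_funD => //; exact: measurable_funM.
  (* The exponential of the minimum of 1 and [y] is at most [1 + 3 * y]. The constant of
     [noise_rate] is this 3, times 16 from [sig2], times 1024. *)
  move=> w; rewrite /noise_part /small_part.
  set y := lam ^+ 2 * _.
  have -> : k * dotv (Z w : 'cV[R]_d) (Z w) ^+ 2 = 3 * y by rewrite /k /y /sig2; ring.
  have y0 : 0 <= y by rewrite /y; apply: mulr_ge0; exact: sqr_ge0.
  have [y1|y1] := leP 1 y.
    have := expR_le_quad (lexx (1 : R)); lra.
  have := expR_le_quad (ltW y1); nra.
have Ksb : 0 < K%:R * sb by rewrite mulr_gt0.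
apply: le_trans (integral_1D_le k0 mN (fun=> sqr_ge0 _)
  (integral_sqnorm2_le cov moment d0 Ksb S_tr)) _.
rewrite lee_fin; apply: le_trans (expR_ge1Dx _).
rewrite lerD2l /noise_rate /k le_eqVlt; apply/orP; left; apply/eqP.
by field; rewrite gt_eqF.
Qed.

End rates.

End covariance_deviation.

(** * The deviation inequality *)

Section measurability.
Context {R : realType} {d K : nat}.
Variables (S : 'M[R]_d) (sb lam gam tau : R).
Local Notation TH := {ffun 'I_d * 'I_K -> bool}.

Lemma measurable_linear_excess (th : TH) :
  measurable_fun [set: borel_cV R d] (fun z : borel_cV R d => linear_excess S sb gam tau th z).
Proof.
rewrite /linear_excess; case: (good S sb th); last exact: measurable_cst.
apply: measurable_funM => //; apply: measurable_maxr => //; apply: measurable_funB => //.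
by apply: measurableT_comp => //; exact: measurable_dotv.
Qed.

Lemma measurable_clipped_product (p : TH * TH) :
  measurable_fun [set: borel_cV R d] (fun z : borel_cV R d => clipped_product lam p z).
Proof.
apply: measurable_maxr => //; apply: measurable_minr => //; apply: measurable_funM => //.
by apply: measurable_funM; exact: measurable_dotv.
Qed.

Lemma measurable_noise_part :
  measurable_fun [set: borel_cV R d] (fun z : borel_cV R d => noise_part (K := K) lam z).
Proof.
apply: measurable_minr => //; apply: measurable_funM => //; apply: measurable_funX.
by apply: measurable_funM => //; exact: measurable_dotvv.
Qed.

End measurability.

Lemma dotv_sample_covariance {R : realType} (n d : nat) (z : 'I_n -> 'cV[R]_d) (u v : 'cV[R]_d) :
  dotv u (sample_covariance z *m v) = n%:R^-1 * \sum_i dotv u (z i) * dotv v (z i).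
Proof.
rewrite /sample_covariance -scalemxAl dotvZr mulmx_suml; congr (_ * _).
rewrite /dotv mulmx_sumr summxE; apply: eq_bigr => i _.
rewrite !mulmxA -mulmxA mxE big_ord1; congr (_ * _).
by rewrite -/(dotv _ _) dotvC.
Qed.

(** The witness has [q ^+ 2 = max (1, sqrt (N / x))]. If the maximum is 1, [x <= x ^+ 2] gives the
    first term on the right; otherwise the left side is exactly the second. *)
Lemma scale_tradeoff {R : realType} (x N : R) : 1 <= x -> 0 < N ->
  exists2 q : R, 0 < q & N <= x * q ^+ 4 /\
    q ^+ 2 * x / N <= Num.max (x ^+ 2 / N) (Num.sqrt (x / N)).
Proof.
move=> x1 N0; have x0 : 0 < x by lra.
pose y := Num.sqrt (x / N); have y0 : 0 < y by rewrite sqrtr_gt0 divr_gt0.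
have y2 : y ^+ 2 = x / N by rewrite sqr_sqrtr// ltW// divr_gt0.
pose L := Num.max 1 y^-1.
have L0 : 0 < L by rewrite lt_max ltr01.
exists (Num.sqrt L); first by rewrite sqrtr_gt0.
have -> : Num.sqrt L ^+ 4 = L ^+ 2 by rewrite (exprM _ 2 2) sqr_sqrtr// ltW.
rewrite sqr_sqrtr ?(ltW L0)//; split.
  have : y^-1 ^+ 2 <= L ^+ 2.
    have yL : y^-1 <= L by rewrite le_max lexx orbT.
    have yi : 0 <= y^-1 by rewrite invr_ge0 ltW.
    by rewrite -subr_ge0 subr_sqr mulr_ge0//; lra.
  rewrite exprVn y2 => /(ler_wpM2l (ltW x0)); apply: le_trans.
  by rewrite invf_div mulrCA divff ?gt_eqF// mulr1.
rewrite -mulrA -/y -y2 le_max.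
have [h|h] := leP y^-1 1; apply/orP; [left|right].
  have -> : L = 1 by rewrite /L max_l.
  rewrite mul1r y2; apply: ler_wpM2r; first by rewrite invr_ge0 ltW.
  by rewrite expr2 ler_peMl// ltW.
have -> : L = y^-1 by rewrite /L max_r// ltW.
by rewrite expr2 mulKf ?gt_eqF.
Qed.

Section deviation.
Context {R : realType} {n d : nat} {disp0 disp : measure_display}
  {T0 : measurableType disp0} (P0 : probability T0 R)
  {T : measurableType disp} (P : probability T R)
  (Z : {RV P0 >-> borel_cV R d}) (Zs : 'I_n -> {RV P >-> borel_cV R d}).
Variables (Sigma : 'M[R]_d) (eta : R).
Hypothesis n0 : (0 < n)%N.
Hypothesis d0 : (0 < d)%N.
Hypothesis indep : independent_RVs Zs.
Hypothesis idd : forall i : 'I_n, same_distribution (Zs i) Z.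
Hypothesis cov : has_mean P0 (fun w => (Z w : 'cV[R]_d) *m (Z w : 'cV[R]_d)^T) Sigma.
Hypothesis eta1 : 1 <= eta.
Hypothesis moment : forall (u : 'cV[R]_d) (p : R), 1 <= p ->
  ('N[P0]_p%:E[(fun w => (dotv u (Z w))%:E)] <= (eta * p * normS Sigma u)%:E)%E.

Definition dev_cst : R := cst_small + 2 * cst_big.

Lemma dev_cst_gt0 : 0 < dev_cst.
Proof.
have k1 := @kurt_ge1 R; have := sqr_ge0 (96 * (1 + @cst_exp R) / pzc ^+ 2).
by rewrite /dev_cst /cst_small -/cst_big; lra.
Qed.

Lemma measurable_deviation (B : R) : 0 <= B ->
  measurable [set w | opnorm (sample_covariance (fun i => Zs i w : 'cV[R]_d) - Sigma) <= B].
Proof.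
move=> B0; apply: measurable_opnorm_le => // i j.
have mc k l : measurable_fun [set: T] (fun w => (Zs k w : 'cV[R]_d) l 0).
  have mZ : measurable_fun [set: T] (Zs k) by exact: measurable_funPT.
  exact: (measurableT_comp (measurable_coord l) mZ).
rewrite (_ : (fun w => _) = (fun w => n%:R^-1 *
    (\sum_(k < n) (Zs k w : 'cV[R]_d) i 0 * (Zs k w : 'cV[R]_d) j 0) - Sigma i j)); last first.
  apply/funext => w; rewrite !mxE summxE; congr (_ * _ - _); apply: eq_bigr => k _.
  by rewrite mxE big_ord1 mxE.
apply: measurable_funB => //; apply: measurable_funM => //.
by apply: measurable_sum => k; exact: measurable_funM.
Qed.

(** Here [sb] is any upper bound of the operator norm; this freedom is what handles large effective
    ranks. *)
Lemma covariance_deviation (K : nat) (sb t B : R) :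
    (0 < K)%N -> 0 < sb -> opnorm Sigma <= sb -> \tr Sigma <= K%:R * sb -> 0 <= t ->
    let x := K%:R + t + ln 8 in
    dev_cst * eta ^+ 2 * sb * Num.max (x ^+ 2 / n%:R) (Num.sqrt (x / n%:R)) <= B ->
  ((1 - expR (- t))%:E <=
   P [set w | (opnorm (sample_covariance (fun i => Zs i w : 'cV[R]_d) - Sigma) <= B)%R])%E.
Proof.
move=> K0 sb0 S_op S_tr t0 x xB.
have e0 : 0 < eta by exact: lt_le_trans ltr01 eta1.
have N0 : 0 < n%:R :> R by rewrite ltr0n.
have ln8 : 0 < ln 8 :> R by rewrite ln_gt0//; lra.
have x1 : 1 <= x.
  have : 1 <= K%:R :> R by rewrite ler1n.
  rewrite /x; lra.
have B0 : 0 <= B.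
  apply: le_trans xB; apply: mulr_ge0; last by rewrite le_max sqrtr_ge0 orbT.
  apply: mulr_ge0; last exact: ltW.
  by apply: mulr_ge0; [exact: ltW dev_cst_gt0|exact: sqr_ge0].
have [q q0 [nx Lx]] := scale_tradeoff x1 N0.
pose g := eta * Num.sqrt sb.
have g0 : 0 < g by rewrite mulr_gt0// sqrtr_gt0.
have gE : g ^+ 2 = eta ^+ 2 * sb by rewrite exprMn sqr_sqrtr// ltW.
have S_psd u : 0 <= dotv u (Sigma *m u) := quad_ge0 cov moment u.
have S_op' (u : 'cV[R]_d) : norm2 u <= 1 -> dotv u (Sigma *m u) <= sb.
  by move=> u1; apply: le_trans S_op; exact: dotv_mulmx_le_opnorm.
(* Three exceptional events share the failure probability; [ln 8] in [x] absorbs [ln 3]. *)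
pose t1 := t + ln 3.
have tx : t1 <= x.
  have : ln 3 <= ln 8 :> R by rewrite ler_ln ?posrE; lra.
  have := ler0n R K; rewrite /t1 /x; lra.
have Kx : K%:R <= x by rewrite /x; lra.
have tl0 (th : {ffun 'I_d * 'I_K -> bool}) : 0 <= tilt (fun=> 0 : R) th.
  by apply: tilt_ge0 => p; rewrite normr0.
have tl1 : \sum_(th : {ffun 'I_d * 'I_K -> bool}) tilt (fun=> 0 : R) th = 1.
  rewrite -[RHS](tE_cst (fun _ : 'I_d * 'I_K => 0 : R) 1).
  by apply: eq_bigr => th _; rewrite mulr1.
have [mE1 E1] := pac_bayes t1 indep idd tl0 tl1
  (fun th => measurable_linear_excess Sigma sb (slope g) (threshold g q) th)
  (linear_excess_mgf cov eta1 moment q g0 gE).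
have tl0' (p : {ffun 'I_d * 'I_K -> bool} * {ffun 'I_d * 'I_K -> bool}) :
    0 <= tilt (fun=> 0 : R) p.1 * tilt (fun=> 0 : R) p.2 by exact: mulr_ge0.
have tl1' : \sum_(p : {ffun 'I_d * 'I_K -> bool} * {ffun 'I_d * 'I_K -> bool})
    tilt (fun=> 0 : R) p.1 * tilt (fun=> 0 : R) p.2 = 1.
  rewrite -(pair_bigA _ (fun th nu => tilt (fun=> 0 : R) th * tilt (fun=> 0 : R) nu)) /=.
  under eq_bigr do rewrite -mulr_sumr tl1 mulr1.
  exact: tl1.
have [mE2 E2] := pac_bayes t1 indep idd tl0' tl1'
  (fun p => measurable_clipped_product (scale g q) p)
  (clipped_product_mgf cov moment g q sb0).
(* The noise does not depend on the direction: a one-point prior reduces [pac_bayes] to a Chernoff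
   bound. *)
have u1 : \sum_(i : unit) (1 : R) = 1 by rewrite sumr_const card_unit.
have [mE3 E3] := pac_bayes t1 indep idd (fun _ : unit => ler01) u1
  (fun _ => measurable_noise_part (K := K) (scale g q))
  (fun _ => noise_part_mgf cov moment g q d0 K0 sb0 S_tr).
move: mE1 E1 mE2 E2 mE3 E3.
set A1 := [set w | _]; set A2 := [set w | expR t1 < \sum_p _]; set A3 := [set w | _].
move=> mE1 E1 mE2 E2 mE3 E3.
set G := [set w | _].
have mG : measurable G by exact: measurable_deviation.
have sub : ~` G `<=` A1 `|` A2 `|` A3.
  apply: subsetCl => w /= /not_orP[/not_orP[]].
  move=> /negP; rewrite -leNgt => h1 /negP; rewrite -leNgt => h2 /negP; rewrite -leNgt => h3.
  rewrite /G /=; apply: opnorm_le_bilinear => // u v un vn.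
  have h3' : \sum_i noise_part (K := K) (scale g q) (Zs i w) -
      n%:R * noise_rate eta sb (scale g q) <= t1.
    by move: h3; rewrite (big_pred1 tt) => [|[]//]; rewrite mul1r ler_expR.
  have := deterministic_bound K0 S_psd sb0 S_op' S_tr g0 q0 gE Kx tx nx h1 h2 h3' un vn.
  have dotvN (a : 'cV[R]_d) : dotv u (- a) = - dotv u a.
    by rewrite -scaleN1r dotvZr mulN1r.
  rewrite mulmxBl dotvDr dotvN dotv_sample_covariance.
  have Ni : 0 <= n%:R^-1 :> R by rewrite invr_ge0 ltW.
  move=> /(ler_wpM2l Ni); rewrite mulrBr mulKf ?gt_eqF// => /le_trans; apply.
  apply: le_trans xB; rewrite gE.
  set mx := Num.max _ _ in Lx *.
  have x2 : x ^+ 2 / n%:R <= mx by rewrite /mx le_max lexx.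
  have es0 : 0 <= eta ^+ 2 * sb by apply: mulr_ge0; [exact: sqr_ge0|exact: ltW].
  have cs0 : 0 <= cst_small :> R.
    by have := @kurt_ge1 R; rewrite /cst_small; lra.
  have cb0 : 0 <= cst_big :> R by exact: sqr_ge0.
  have := lerD (ler_wpM2l cs0 Lx) (ler_wpM2l (mulr_ge0 (ler0n R 2) cb0) x2).
  move=> /(ler_wpM2l es0).
  rewrite -(mulrDl cst_small) (_ : dev_cst * _ * _ * mx = eta ^+ 2 * sb * ((cst_small + 2 * cst_big) * mx)); last by rewrite /dev_cst; ring.
  apply: le_trans; rewrite le_eqVlt; apply/orP; left; apply/eqP.
  by field; rewrite gt_eqF.
have : (P (~` G) <= (expR (- t))%:E)%E.
  have mC : measurable (~` G) by exact: measurableC.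
  have m12 : measurable (A1 `|` A2) by exact: measurableU.
  have mU : measurable (A1 `|` A2 `|` A3) by exact: measurableU.
  apply: le_trans (le_measure P (mem_set mC) (mem_set mU) sub) _.
  apply: le_trans (measureU2 P m12 mE3) _.
  apply: le_trans (leeD (measureU2 P mE1 mE2) (lexx _)) _.
  apply: le_trans (leeD (leeD E1 E2) E3) _.
  rewrite -!EFinD lee_fin /t1 opprD expRD (expRN (ln 3)) lnK ?posrE; last by lra.
  lra.
rewrite probability_setC// => h.
have PG : (P G = (fine (P G))%:E)%E by rewrite fineK// fin_num_measure.
move: h; rewrite PG -EFinB !lee_fin; lra.
Qed.

End deviation.

Theorem theorem4 (R : realType) :
  exists c : R, 0 < c /\
  forall (n d : nat), (1 <= n)%N -> (1 <= d)%N ->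
  forall (disp0 disp : measure_display)
    (T0 : measurableType disp0) (P0 : probability T0 R)
    (T : measurableType disp) (P : probability T R)
    (Z : {RV P0 >-> borel_cV R d}) (Zs : 'I_n -> {RV P >-> borel_cV R d})
    (Sigma : 'M[R]_d) (eta : R),
  independent_RVs Zs ->
  (forall i : 'I_n, same_distribution (Zs i) Z) ->
  has_mean P0 (fun w => Z w : 'cV[R]_d) 0 ->
  has_mean P0 (fun w => (Z w : 'cV[R]_d) *m (Z w : 'cV[R]_d)^T) Sigma ->
  Sigma != 0 ->
  1 <= eta ->
  (forall (u : 'cV[R]_d) (p : R), 1 <= p ->
    ('N[P0]_p%:E[(fun w => (dotv u (Z w))%:E)]
       <= (eta * p * normS Sigma u)%:E)%E) ->
  forall t : R, 0 <= t ->
  ((1 - expR (- t))%:E <=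
    P [set w | (opnorm (sample_covariance (fun i => Zs i w : 'cV[R]_d) - Sigma)
                <= deviation_bound c eta (opnorm Sigma) (effective_rank Sigma) t n)%R])%E.
Proof.
(* The factor 9 pays for [x <= 3 * b] squared in the cases below. *)
exists (9 * dev_cst); split; first by have := @dev_cst_gt0 R; lra.
move=> n d n0 d0 disp0 disp T0 P0 T P Z Zs Sigma eta indep idd _ cov S0 eta1 moment t t0.
set s := opnorm Sigma; set r := effective_rank Sigma.
have s0 : 0 < s by exact: opnorm_gt0.
have trE : \tr Sigma = r * s by rewrite /r /effective_rank divfK// gt_eqF.
have r0 : 0 <= r.
  by apply: divr_ge0; [exact: (trace_cov_ge0 cov moment)|exact: ltW].
have N0 : 0 < n%:R :> R by rewrite ltr0n.
have C0 := @dev_cst_gt0 R.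
have l8 : 1 <= ln 8 :> R.
  rewrite -[leLHS]expRK ler_ln ?posrE ?expR_gt0//.
  have := expR_le_quad (lexx (1 : R)); lra.
have Ce0 : 0 <= dev_cst * eta ^+ 2 by apply: mulr_ge0; [exact: ltW|exact: sqr_ge0].
have trunc1 (y : R) : 0 <= y -> y <= (Num.truncn y).+1%:R <= y + 1.
  move=> y0; have /andP[h1 h2] := truncn_itv y0.
  by rewrite (ltW h2) /= -natr1; lra.
rewrite /deviation_bound; set k := n%:R `^ 3^-1.
have k0 : 0 <= k by exact: powR_ge0.
have k3 : k ^+ 3 = n%:R.
  by rewrite -powR_mulrn ?powR_ge0// -powRrM mulVf// powRr1// ltW.
case: ifPn => [_|].
  (* Rounding [r] up to the integer [K] costs at most 1, which is at most [ln 8]. *)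
  have /andP[rK Kr] := trunc1 r r0.
  apply: (covariance_deviation n0 d0 indep idd cov eta1 moment (K := (Num.truncn r).+1) (sb := s)) => //.
    by rewrite trE ler_pM2r.
  set x := _%:R + t + ln 8; set a := r + t + ln 8.
  have x0 : 0 <= x by rewrite /x; have := ler0n R (Num.truncn r).+1; lra.
  have xa : x <= 2 * a by rewrite /x /a; lra.
  have a0 : 0 <= a by rewrite /a; lra.
  have -> : 9 * dev_cst * eta ^+ 2 * s = dev_cst * eta ^+ 2 * s * 9 by ring.
  rewrite -[leRHS]mulrA; apply: ler_wpM2l; first by apply: mulr_ge0 => //; exact: ltW.
  rewrite ge_max; apply/andP; split.
    apply: (@le_trans _ _ (9 * (a ^+ 2 / n%:R))).
      rewrite mulrA; apply: ler_wpM2r; first by rewrite invr_ge0 ltW.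
      nra.
    by rewrite ler_pM2l// le_max lexx.
  apply: (@le_trans _ _ (9 * Num.sqrt (a / n%:R))); last first.
    by rewrite ler_pM2l// le_max lexx orbT.
  rewrite -[9](@ger0_norm R)// -sqrtr_sqr -sqrtrM ?sqr_ge0// ler_wsqrtr//.
  rewrite mulrA; apply: ler_wpM2r; first by rewrite invr_ge0 ltW.
  lra.
rewrite -ltNge => kr; set b := k + t + ln 8.
have b1 : 1 <= b by rewrite /b; lra.
(* This makes the square-root term at most a multiple of [b ^+ 2 / n]. *)
have nb : n%:R <= b ^+ 3.
  by rewrite -k3 lerXn2r ?nnegrE//; rewrite /b; lra.
have rate (x : R) : 0 <= x -> x <= 3 * b ->
    Num.max (x ^+ 2 / n%:R) (Num.sqrt (x / n%:R)) <= 9 * (b ^+ 2 / n%:R).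
  move=> x0 xb; rewrite ge_max; apply/andP; split.
    rewrite mulrA; apply: ler_wpM2r; first by rewrite invr_ge0 ltW.
    nra.
  have b0 : 0 <= 9 * (b ^+ 2 / n%:R).
    by apply: mulr_ge0 => //; apply: divr_ge0; [exact: sqr_ge0|exact: ltW].
  rewrite -[leRHS](ger0_norm b0) -sqrtr_sqr ler_wsqrtr//.
  have -> : (9 * (b ^+ 2 / n%:R)) ^+ 2 = 81 * b * b ^+ 3 / n%:R / n%:R.
    by field; rewrite gt_eqF.
  apply: ler_wpM2r; first by rewrite invr_ge0 ltW.
  rewrite ler_pdivlMr//.
  apply: (@le_trans _ _ (3 * b * b ^+ 3)); first by apply: ler_pM => //; lra.
  by apply: ler_wpM2r; [apply: exprn_ge0; lra|lra].
(* For [r] between [n^(1/3)] and [b], taking [K] of order [r] is still affordable and [sb] need not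
   be inflated. *)
have [rb|br] := leP r b.
  have /andP[rK Kr] := trunc1 r r0.
  apply: (covariance_deviation n0 d0 indep idd cov eta1 moment (K := (Num.truncn r).+1) (sb := s)) => //.
    by rewrite trE ler_pM2r.
  set x := _%:R + t + ln 8.
  have x0 : 0 <= x by rewrite /x; have := ler0n R (Num.truncn r).+1; lra.
  have xb : x <= 3 * b by move: rb; rewrite /x /b; lra.
  have -> : 9 * dev_cst * eta ^+ 2 * s = dev_cst * eta ^+ 2 * s * 9 by ring.
  rewrite -[leRHS]mulrA; apply: ler_wpM2l; first by apply: mulr_ge0 => //; exact: ltW.
  apply: le_trans (rate x x0 xb) _.
  by rewrite ler_pM2l// le_max lexx.
have b0 : 0 < b by lra.
have /andP[bK Kb] := trunc1 b (ltW b0).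
(* With [K] of order [b], the choice [sb = s * (r / b)] keeps [\tr Sigma <= K * sb], and
   [sb * b ^+ 2 / n] becomes [s * r * b / n]. *)
have rb1 : 1 <= r / b by rewrite ler_pdivlMr// mul1r ltW.
apply: (covariance_deviation n0 d0 indep idd cov eta1 moment (K := (Num.truncn b).+1) (sb := s * (r / b))) => //.
- by rewrite mulr_gt0//; lra.
- by rewrite ler_peMr// ltW.
- rewrite trE (_ : r * s = b * (s * (r / b))); last by field; rewrite gt_eqF.
  by apply: ler_wpM2r => //; apply: mulr_ge0; [exact: ltW|lra].
set x := _%:R + t + ln 8.
have x0 : 0 <= x by rewrite /x; have := ler0n R (Num.truncn b).+1; lra.
have xb : x <= 3 * b by move: Kb; rewrite /x /b; lra.
have sr0 : 0 <= dev_cst * eta ^+ 2 * (s * (r / b)).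
  by apply: mulr_ge0 => //; apply: mulr_ge0; [exact: ltW|lra].
apply: le_trans (ler_wpM2l sr0 (rate x x0 xb)) _.
rewrite (_ : dev_cst * _ * _ * _ = 9 * dev_cst * eta ^+ 2 * s * (r * b / n%:R)); last first.
  by field; rewrite !gt_eqF.
apply: ler_wpM2l; last by rewrite le_max lexx orbT.
by apply: mulr_ge0; [apply: mulr_ge0; [lra|exact: sqr_ge0]|exact: ltW].
Qed.
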